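(* Let $G$ be any group and let $A$, $B$ and $F$ be nontrivial free subgroups of $G$. Then $$\operatorname{rank}(A\cap B)-1\le |G:F|\cdot(\operatorname{rank}(A)-1)\cdot(\operatorname{rank}(B)-1).$$
   Context: For a free group $H$, $\operatorname{rank}(H)$ is the cardinality of a free basis of $H$ (the trivial group is free of rank $0$). $|G:F|$ denotes the index of $F$ in $G$. No finiteness is assumed on the ranks or on the index; the inequality is understood in the sense of cardinal arithmetic (so $\kappa-1=\kappa$ for infinite $\kappa$, and $0\cdot\kappa=0$); if $A\cap B$ is trivial the left-hand side is $-1$. *)

(* Defs.v *)
From HB Require Import structures.
From mathcomp Require Import all_boot.
From mathcomp Require Import boolp classical_sets functions cardinality.

Set Implicit Arguments.
Unset Strict Implicit.
Unset Printing Implicit Defensive.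

Local Open Scope classical_set_scope.
Local Open Scope group_scope.

(* The letter (x, false) stands for x and (x, true) for x^-1. *)
Definition letter (G : groupType) (l : G * bool) : G :=
  if l.2 then l.1^-1 else l.1.

Definition word_value (G : groupType) (w : seq (G * bool)) : G :=
  \prod_(l <- w) letter l.

Definition word_over (G : groupType) (X : set G) (w : seq (G * bool)) : Prop :=
  forall l, l \in w -> X l.1.

Definition reduced (G : groupType) (w : seq (G * bool)) : bool :=
  sorted (fun l m => ~~ ((l.1 == m.1) && (l.2 != m.2))) w.

(* The evaluation map from reduced words over X is a bijection onto H, i.e. the
   inclusion of X induces an isomorphism from the free group on X onto H. *)
Definition free_basis (G : groupType) (H X : set G) : Prop :=
  X `<=` H /\
  forall h, H h ->
    exists! w, [/\ word_over X w, reduced w & word_value w = h].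

Definition subgroup (G : groupType) (H : set G) : Prop :=
  group_closed (mem H).

Definition free_subgroup (G : groupType) (H : set G) : Prop :=
  subgroup H /\ exists X, free_basis H X.

Definition left_cosets (G : groupType) (F : set G) : set (set G) :=
  [set [set g * f | f in F] | g in [set: G]].

(* Cardinals are represented by sets and compared with #<=, products of
   cardinals being cartesian products.  If S is nonempty, minus_one S is S
   with one of its points removed, so it represents |S| - 1 (and |S| - 1 = |S|
   when S is infinite); it is not meant to be used on the empty set. *)
Definition minus_one (T : choiceType) (x0 : T) (S : set T) : set T :=
  S `\ xget x0 S.

(* |S| - 1 <= |C|, where |S| - 1 is -1, hence below every cardinal, if S is
   empty. *)
Definition minus_one_le (T : choiceType) (U : Type) (x0 : T)
    (S : set T) (C : set U) : Prop :=
  S = set0 \/ (minus_one x0 S #<= C)%card.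

(* Main.v *)
Require Import Defs.
From mathcomp Require Import all_boot ssralg ssrnum ssrint.
From mathcomp Require Import zify.
From mathcomp Require Import boolp classical_sets functions cardinality wochoice.

(* Let W be a basis of F and n = |G:F|.  The Cayley graph of G with respect to W
   is a forest with one tree for each left coset of F; G acts on it freely from
   the left, and a left order on the free group F gives a G-invariant order on
   the edges of each tree.  Let V be a subforest with finite quotient by a free
   subgroup H of rank r, meeting every coset of F in a nonempty subtree.  As in
   the proofs of Mineyev and Dicks, call an edge of V a bridge if both of its
   ends start a ray in V (not crossing the edge) all of whose edges are smaller.
   Every vertex starts exactly one ray without bridges all of whose tails have a
   largest edge, and the first edge of this ray defines an H-equivariant
   bijection from the vertices to the nonbridges; hence the number of H-orbits of
   bridges is |E/H| - |V/H|, which an Euler characteristic count shows to be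
   n (r - 1).  A bridge of the intersection of subforests for A and B is a bridge
   of both, and its orbit under A `&` B is determined by its orbits under A and B;
   this gives n (rank (A `&` B) - 1) <= n (rank A - 1) * n (rank B - 1).  The
   cases left are those where A or B is cyclic, and those where the right-hand
   side is infinite, which follow from |D * D| = |D| for infinite D. *)

Set Implicit Arguments.
Unset Strict Implicit.
Unset Printing Implicit Defensive.

Local Open Scope classical_set_scope.
Local Open Scope group_scope.

(** * Free bases and reduced words *)

(** The difference between edges and vertices modulo the group is not monotone in the subforest, so
    it cannot be compared directly for the intersection and for [A], [B]. The number of orbits of
    bridges is the same difference, but a bridge is witnessed by rays, and rays survive when the
    subforest grows. The groups are not assumed to lie in F; they permute the trees, and V/H is not
    a graph with fundamental group H. Its components correspond to the H-orbits of cosets gF, with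
    fundamental groups the intersections of H with gFg^-1; their Euler characteristics add up to n
    (1 - r). The proof gets this total by a dimension count, without finding bases of these
    intersections. All three groups are measured on the same n trees, so n occurs once on the left
    and twice on the right; cancelling one of them leaves the index in the theorem. The rank of the
    intersection is not known to be finite beforehand. This is why upper and lower estimates are
    separate: the lower one accepts any finite part of a basis. *)

Section Words.
Variable G : groupType.
Implicit Types (l m : G * bool) (u v w : seq (G * bool)) (H X : set G).

Definition linv l := (l.1, ~~ l.2).

Definition winv w := rev (map linv w).

Lemma linvK : involutive linv.
Proof. by case=> x b; rewrite /linv /= negbK. Qed.

Lemma letter_linv l : letter (linv l) = (letter l)^-1.
Proof. by case: l => x []; rewrite /letter /= ?invgK. Qed.

Lemma word_value_nil : word_value [::] = 1 :> G.
Proof. by rewrite /word_value big_nil. Qed.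

Lemma word_value_cons l w : word_value (l :: w) = letter l * word_value w.
Proof. by rewrite /word_value big_cons. Qed.

Lemma word_value_cat u v : word_value (u ++ v) = word_value u * word_value v.
Proof. by rewrite /word_value big_cat. Qed.

Lemma word_value_winv w : word_value (winv w) = (word_value w)^-1.
Proof.
elim: w => [|l w IH]; first by rewrite /winv /= word_value_nil invg1.
rewrite /winv /= rev_cons -cats1 word_value_cat -/(winv w) IH.
by rewrite !word_value_cons word_value_nil letter_linv mulg1 invgM.
Qed.

Definition nocancel l m := m != linv l.

Lemma nocancelC l m : nocancel (linv m) (linv l) = nocancel l m.
Proof. by rewrite /nocancel (inj_eq (inv_inj linvK)) eq_sym (can2_eq linvK linvK). Qed.

Lemma reducedE w : reduced w = sorted nocancel w.
Proof.
apply: eq_sorted => -[x b] [y c]; rewrite /nocancel /linv /= xpair_eqE.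
by rewrite [y == x]eq_sym; case: b c => [] [].
Qed.

Lemma reduced_cons l w :
  reduced (l :: w) = (if w is m :: _ then nocancel l m else true) && reduced w.
Proof. by rewrite !reducedE; case: w. Qed.

Lemma reduced_winv w : reduced (winv w) = reduced w.
Proof.
rewrite !reducedE rev_sorted sorted_map; apply: eq_sorted => l m /=.
exact: nocancelC.
Qed.

Lemma word_over_cons X l w : word_over X (l :: w) <-> X l.1 /\ word_over X w.
Proof.
split=> [h|[h1 h2] m]; first split.
- by apply: h; rewrite mem_head.
- by move=> m mw; apply: h; rewrite inE mw orbT.
by rewrite inE => /orP[/eqP->//|]; apply: h2.
Qed.

Lemma word_over_nil X : word_over X [::].
Proof. by move=> l. Qed.

Lemma word_over_cat X u v : word_over X (u ++ v) <-> word_over X u /\ word_over X v.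
Proof.
split=> [h|[h1 h2] m]; first by split=> m mw; apply: h; rewrite mem_cat mw ?orbT.
by rewrite mem_cat => /orP[]; [apply: h1|apply: h2].
Qed.

Lemma word_over_winv X w : word_over X w -> word_over X (winv w).
Proof. by move=> h l; rewrite mem_rev => /mapP[m mw ->]; apply: (h m). Qed.

Lemma subgroup1 H : subgroup H -> H 1.
Proof. by case=> /set_mem. Qed.

Lemma subgroupM H x y : subgroup H -> H x -> H y -> H (x * y).
Proof.
by move=> sH /mem_set Hx /mem_set Hy; apply/set_mem; apply: (group_closedM sH).
Qed.

Lemma subgroupV H x : subgroup H -> H x -> H x^-1.
Proof. by move=> sH /mem_set Hx; apply/set_mem; apply: (group_closedV sH). Qed.

Lemma subgroupI H K : subgroup H -> subgroup K -> subgroup (H `&` K).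
Proof.
move=> sH sK; split; first by apply/mem_set; split; apply: subgroup1.
move=> x y /set_mem[Hx Kx] /set_mem[Hy Ky]; apply/mem_set.
by split; apply: subgroupM => //; apply: subgroupV.
Qed.

Lemma letter_in H X l : subgroup H -> X `<=` H -> X l.1 -> H (letter l).
Proof.
by move=> sH sub Xl; rewrite /letter; case: l.2; [apply: subgroupV => //|];
   apply: sub.
Qed.

Lemma word_value_in H X w :
  subgroup H -> X `<=` H -> word_over X w -> H (word_value w).
Proof.
move=> sH sub; elim: w => [|l w IH]; first by rewrite word_value_nil; move=> _; apply: subgroup1.
move=> /word_over_cons[Xl Xw]; rewrite word_value_cons; apply: subgroupM => //.
  exact: letter_in sub Xl.
exact: IH.
Qed.

Definition fword X h : seq (G * bool) :=
  xget [::] [set w | [/\ word_over X w, reduced w & word_value w = h]].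

Section FreeBasis.
Variables (H X : set G).
Hypotheses (sH : subgroup H) (fb : free_basis H X).

Lemma basis_sub : X `<=` H. Proof. by case: fb. Qed.

Lemma fwordP h : H h ->
  [/\ word_over X (fword X h), reduced (fword X h) & word_value (fword X h) = h].
Proof.
by move=> /(fb.2)[w [Pw _]]; exact: (@xgetI _ _ [set w | _] w Pw).
Qed.

Lemma fword_value w : word_over X w -> reduced w -> fword X (word_value w) = w.
Proof.
move=> ow rw; have Hw := word_value_in sH basis_sub ow.
have [w0 [_ uw]] := fb.2 _ Hw.
by rewrite -(uw _ (fwordP Hw)); apply: uw.
Qed.

Lemma fword1 : fword X 1 = [::].
Proof. by rewrite -word_value_nil fword_value //; exact: word_over_nil. Qed.

Lemma fword_inj h k : H h -> H k -> fword X h = fword X k -> h = k.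
Proof. by move=> /fwordP[_ _ {2}<-] /fwordP[_ _ {2}<-] ->. Qed.

Lemma fwordV h : H h -> fword X h^-1 = winv (fword X h).
Proof.
move=> /fwordP[o r e]; rewrite -{1}e -word_value_winv fword_value ?reduced_winv //.
exact: word_over_winv.
Qed.

Lemma word_over1 l : X l.1 -> word_over X [:: l].
Proof. by move=> Xl; apply/word_over_cons; split=> //; apply: word_over_nil. Qed.

(** The second case is cancellation, written with the shorter word as the tail of the longer one: a
    function defined by recursion on words changes by one letter in both cases. *)
Lemma fword_cons l h : X l.1 -> H h ->
  fword X (letter l * h) = l :: fword X h \/
  fword X h = linv l :: fword X (letter l * h).
Proof.
move=> Xl Hh; have := fwordP Hh.
case: (fword X h) => [|m w] [o r e]; last have [eml|nml] := eqVneq m (linv l).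
- left; rewrite -e word_value_nil mulg1.
  have -> : letter l = word_value [:: l].
    by rewrite word_value_cons word_value_nil mulg1.
  by rewrite fword_value //; apply: word_over1.
- right; move: o r; rewrite -e eml => /word_over_cons[_ ow].
  rewrite reduced_cons => /andP[_ rw].
  by rewrite word_value_cons letter_linv mulVKg fword_value.
- left; rewrite -e -word_value_cons fword_value //.
    by apply/word_over_cons.
  by rewrite reduced_cons [nocancel _ _]nml.
Qed.

Lemma basis_letter_inj l m : X l.1 -> X m.1 -> letter l = letter m -> l = m.
Proof.
move=> /word_over1 Xl /word_over1 Xm e.
have: word_value [:: l] = word_value [:: m] by rewrite !word_value_cons e.
by move/(congr1 (fword X)); rewrite !fword_value // => -[].
Qed.

Lemma basis_expgn_neq1 x n : X x -> (0 < n)%N -> x ^+ n != 1.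
Proof.
move=> Xx n0; apply/eqP => e.
have E : word_value (nseq n (x, false)) = x ^+ n.
  by elim: {n0 e} n => [|n IH]; rewrite ?word_value_nil // word_value_cons IH expgS.
have : fword X (x ^+ n) = nseq n (x, false).
  rewrite -E fword_value // => [l|]; first by move=> /nseqP[-> _].
  rewrite reducedE; case: {n0 e E} n => // n.
  by rewrite /=; elim: n => //= n ->; rewrite /nocancel /linv xpair_eqE eqxx.
by rewrite e fword1; case: n n0 {e E}.
Qed.

Lemma basis_ind (P : G -> Prop) :
  P 1 -> (forall l h, X l.1 -> H h -> P h -> P (letter l * h)) ->
  forall h, H h -> P h.
Proof.
move=> P1 Pl h /fwordP[o _ <-]; elim: (fword X h) o => [|l w IH].
  by rewrite word_value_nil.
move=> /word_over_cons[Xl ow]; rewrite word_value_cons; apply: Pl => //.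
  exact: word_value_in basis_sub ow.
exact: IH.
Qed.

End FreeBasis.
End Words.

(** * A left order on a free group *)

(** Letters carry no natural order. A well-ordering supplies one, used for turns at a vertex and
    later for edges with a common source. *)
Lemma strict_total_order_exists (T : eqType) :
  exists lt : rel T, [/\ irreflexive lt, transitive lt &
    forall x y, x != y -> lt x y || lt y x].
Proof.
have [R woR] := well_ordering_principle T.
have woT : wo_chain R predT by move=> A _; exact: woR.
have Rxx : reflexive R by move=> x; exact: (wo_chain_reflexive woT).
have Rtot x y : R x y || R y x by exact: (wo_chainW woT).
have Rasym : antisymmetric R by move=> x y; exact: (wo_chain_antisymmetric woT).
have Rtr : transitive R.
  (* Transitivity follows by asking which of the three is the least element of {x, y, z}. *)
  move=> y x z xy yz; pose A := [pred t | (t == x) || (t == y) || (t == z)].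
  have [|t [[At lt] _]] := woR A; first by exists x; rewrite inE eqxx.
  have [tx ty tz] : [/\ R t x, R t y & R t z].
    by split; apply: lt; rewrite inE eqxx ?orbT.
  move: At => /orP[/orP[]|] /eqP e; rewrite e in tx ty tz => //.
    by have -> : x = y by apply: Rasym; rewrite xy tx.
  by have <- : y = z by apply: Rasym; rewrite yz ty.
exists (fun x y => R x y && (x != y)); split.
- by move=> x; rewrite eqxx andbF.
- move=> y x z /andP[xy nxy] /andP[yz nyz]; rewrite (Rtr _ _ _ xy yz) /=.
  by apply: contra nxy => /eqP e; apply/eqP/Rasym; rewrite xy e yz.
- by move=> x y nxy; rewrite nxy eq_sym nxy !andbT; exact: Rtot.
Qed.

Section Order.
Variables (G : groupType) (F W : set G).
Hypotheses (sF : subgroup F) (fW : free_basis F W).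
Variable lt : rel (G * bool).
Hypotheses (lt_irr : irreflexive lt) (lt_tr : transitive lt)
  (lt_tot : forall x y, x != y -> lt x y || lt y x).
Implicit Types (l m : G * bool) (u v w : seq (G * bool)).

Import GRing.Theory Num.Theory.
Local Open Scope int_scope.
Local Open Scope ring_scope.

Definition edge_sign l : int := if l.2 then -1 else 1.
Definition turn_sign l m : int := if lt l m then 1 else -1.

Lemma turn_signC l m : l != m -> turn_sign m l = - turn_sign l m.
Proof.
move=> nlm; rewrite /turn_sign; have := lt_tot nlm.
case E: (lt l m); case E': (lt m l) => // _.
by have := lt_tr E E'; rewrite lt_irr.
Qed.

(** A sum of three signs exceeds 1 only if it is 3, which would violate transitivity. The three
    turns are those at the centre of a tripod. *)
Lemma turn_sign_cycle a b c : a != b -> b != c -> a != c ->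
  turn_sign a b + turn_sign b c - turn_sign a c <= 1.
Proof.
move=> ab bc ac; rewrite /turn_sign.
case E: (lt a b); case E': (lt b c) => //; case E'': (lt a c) => //.
by rewrite (lt_tr E E') in E''.
Qed.

(* The quantity of Sunic and Dicks: along the path spelled by w in the Cayley
   tree, count each edge by its direction and each turn by the order of the two
   edges at the vertex.  There are an odd number of signs, so it never vanishes. *)
Fixpoint weight w : int :=
  if w is l :: w' then
    edge_sign l + (if w' is m :: _ then turn_sign (linv l) m else 0) + weight w'
  else 0.

Definition turn u v : int :=
  if u is l :: u' then if v is m :: _ then turn_sign (linv (last l u')) m else 0
  else 0.

Lemma weight_cat u v : weight (u ++ v) = weight u + weight v + turn u v.
Proof.
elim: u => [|l u IH] /=; first by case: v; lia.
by rewrite IH; case: u {IH} => [|m u] /=; case: v => [|n v] /=; lia.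
Qed.

Lemma weight_winv w : reduced w -> weight (winv w) = - weight w.
Proof.
elim: w => [|l w IH]; first by [].
rewrite reduced_cons /winv /= rev_cons -cats1 weight_cat -/(winv w) => /andP[lm rw].
rewrite IH //=; case: w lm {IH rw} => [|m w]; first by rewrite /edge_sign /=; case: l => x [].
move=> lm; have -> : turn (winv (m :: w)) [:: linv l] = - turn_sign (linv l) m.
  rewrite -turn_signC 1?eq_sym // /winv map_cons rev_cons.
  by case: (rev _) => [|k u] /=; rewrite ?last_rcons linvK.
by rewrite /= /edge_sign; case: l {lm} => x [] /=; lia.
Qed.

Lemma weight_neq0 w : w != [::] -> weight w != 0.
Proof.
case: w => // l w _; suff [k ->] : exists k : int, weight (l :: w) = k * 2 + 1 by lia.
elim: w l => [|m w IH] l.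
  by rewrite /= /edge_sign; case: l.2; [exists (-1)|exists 0].
have [k E] := IH m; have -> : weight (l :: m :: w) =
  edge_sign l + turn_sign (linv l) m + weight (m :: w) by [].
rewrite E /edge_sign /turn_sign.
by case: l.2; case: (lt _ _); [exists k|exists (k - 1)|exists (k + 1)|exists k]; lia.
Qed.

(** The words [a], [b], [c] are the legs of the tripod spanned in the tree by 1, the value of [u]
    and the value of [u ++ v]. *)
Lemma cancel_decomposition u v : reduced u -> reduced v -> exists a b c,
  [/\ u = a ++ c, v = winv c ++ b & reduced (a ++ b)].
Proof.
elim/last_ind: u v => [|u l IH] v ru rv; first by exists [::], v, [::].
have ru' : reduced u.
  by move: ru; rewrite !reducedE -cats1 => /cat_sorted2[].
case: v rv => [|m v] rv; first by exists (rcons u l), [::], [::]; rewrite !cats0.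
have [e|nml] := eqVneq m (linv l).
  have rv' : reduced v by move: rv; rewrite reduced_cons => /andP[].
  have [a [b [c [-> -> rab]]]] := IH _ ru' rv'.
  exists a, b, (rcons c l); split=> //; first by rewrite rcons_cat.
  by rewrite /winv map_rcons rev_rcons -e.
exists (rcons u l), (m :: v), [::]; split=> //; first by rewrite cats0.
move: ru rv; rewrite !reducedE; case: u {IH ru'} => [|k u] /= ru rv.
  by rewrite rv andbT.
by rewrite cat_path ru last_rcons /= rv andbT.
Qed.

Definition pos (x : G) := F x /\ 0 < weight (fword W x).

(** The cancelled part [c] contributes to the two weights with opposite signs, so only the three
    turns at the centre of the tripod remain. The error 1 is harmless for positivity, as positive
    weights are at least 1. *)
Lemma fword_mul_weight x y : F x -> F y -> (x * y)%g != 1%g ->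
  weight (fword W x) + weight (fword W y) <= weight (fword W (x * y)%g) + 1.
Proof.
move=> Fx Fy nxy; have [ox rx ex] := fwordP fW Fx; have [oy ry ey] := fwordP fW Fy.
have [a [b [c [ea eb rab]]]] := cancel_decomposition rx ry.
have exy : word_value (a ++ b) = (x * y)%g.
  by rewrite -ex -ey ea eb !word_value_cat word_value_winv mulgA mulgK.
have oab : word_over W (a ++ b).
  move: ox oy; rewrite ea eb => /word_over_cat[? _] /word_over_cat[_ ?].
  by apply/word_over_cat.
have nab : a ++ b != [::] by apply: contra nxy => /eqP e; rewrite -exy e word_value_nil.
rewrite -exy (fword_value sF fW oab rab) ea eb !weight_cat.
have rc : reduced c by move: rx; rewrite ea !reducedE => /cat_sorted2[].
rewrite (weight_winv rc).
suff : turn a c + turn (winv c) b - turn a b <= 1 by lia.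
move: rx ry; rewrite {}ea {}eb {rc exy oab ox oy ex ey}.
have turn1 u v : turn u v <= 1.
  by rewrite /turn; case: u => // ? ?; case: v => // ? ?; rewrite /turn_sign; case: (lt _ _).
have turn0 u v : - turn u v <= 1.
  by rewrite /turn; case: u => // ? ?; case: v => // ? ?; rewrite /turn_sign; case: (lt _ _).
(* If [a], [b] or [c] is empty, at most one of the three turns is nonzero. *)
case/lastP: a nab rab => [|a l]; first by move: (turn1 (winv c) b) => /=; lia.
case: b => [|m b]; first by move=> *; move: (turn1 (rcons a l) c); rewrite /turn; case: (rcons a l) (winv c) => [|? ?] [|? ?]; lia.
case: c => [|k c] _; first by move: (turn0 (rcons a l) (m :: b)); rewrite /= /turn; case: (rcons a l); lia.
have turnr u n v : turn (rcons a l) (n :: v) = turn_sign (linv l) n.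
  by case: a {turn1 turn0} => [|n' a] //=; rewrite last_rcons.
have nc u n (p : G * bool) v : reduced (rcons u n ++ p :: v) -> p != linv n.
  by rewrite reducedE cat_rcons => /cat_sorted2[_ /= /andP[]].
rewrite /winv /= rev_cons -/(winv c) => /nc ml /nc kl /nc; rewrite linvK => mk.
rewrite !turnr //.
have -> : turn (rcons (winv c) (linv k)) (m :: b) = turn_sign k m.
  by case: (winv c) => [|n' c'] /=; rewrite ?last_rcons linvK.
by apply: turn_sign_cycle; rewrite 1?eq_sym.
Qed.

Lemma posM x y : pos x -> pos y -> pos (x * y)%g.
Proof.
move=> [Fx px] [Fy py]; split; first exact: subgroupM.
have [e|nxy] := eqVneq (x * y)%g 1%g; last by have := fword_mul_weight Fx Fy nxy; lia.
have [_ rx _] := fwordP fW Fx.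
by move: py; rewrite -(mulg1_eq e) (fwordV sF fW Fx) weight_winv //; lia.
Qed.

Lemma pos_irr : ~ pos 1%g.
Proof. by case=> _; rewrite (fword1 sF fW). Qed.

Lemma pos_total x : F x -> x != 1%g -> pos x \/ pos x^-1%g.
Proof.
move=> Fx nx; have [ox rx ex] := fwordP fW Fx.
have : weight (fword W x) != 0.
  apply: weight_neq0; apply: contra nx => /eqP e.
  by rewrite -ex e word_value_nil.
rewrite /pos (fwordV sF fW Fx) weight_winv //.
by case: (ltrP 0 (weight (fword W x))) => [?|? ?]; [left|right; split; [exact: subgroupV|lia]].
Qed.

End Order.

(** * Bridges in an ordered forest *)

Inductive reach (T : Type) (R : T -> T -> Prop) (x : T) : T -> Prop :=
| reach_refl : reach R x x
| reach_step y z : reach R x y -> R y z -> reach R x z.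

Section Reach.
Variables (T : Type) (R : T -> T -> Prop).

Lemma reach_trans x y z : reach R x y -> reach R y z -> reach R x z.
Proof. by move=> xy; elim=> // ? ? _ IH; apply: reach_step. Qed.

Lemma reach1 x y : R x y -> reach R x y.
Proof. exact/reach_step/reach_refl. Qed.

Lemma reach_sym x y : (forall u v, R u v -> R v u) -> reach R x y -> reach R y x.
Proof.
move=> Rs; elim=> [|u v _ IH uv]; first exact: reach_refl.
exact: reach_trans (reach1 (Rs _ _ uv)) IH.
Qed.

Lemma reach_exit (D : T -> Prop) x y : D x -> ~ D y -> reach R x y ->
  exists u v, [/\ R u v, D u & ~ D v].
Proof.
move=> Dx nDy xy; elim: xy nDy => [//|u v _ IH uv nDv].
by have [Du|/IH//] := pselect (D u); exists u, v.
Qed.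

Lemma reach_walk x y : reach R x y ->
  exists n (p : nat -> T), [/\ p 0%N = x, p n = y & forall i, i < n -> R (p i) (p i.+1)].
Proof.
elim=> [|u v _ [n [p [p0 pn pR]]] uv]; first by exists 0%N, (fun=> x).
exists n.+1, (fun i => if i <= n then p i else v); split=> //=; first by rewrite ltnn.
move=> i; rewrite ltnS; case: (ltngtP i n) => // [ltin _|-> _]; last by rewrite pn.
exact: pR.
Qed.

End Reach.

Lemma finite_set_minimal (T : eqType) (R : T -> T -> Prop) (B : set T) :
  (forall x, ~ R x x) -> (forall x y z, R x y -> R y z -> R x z) ->
  finite_set B -> B !=set0 -> exists2 b, B b & forall c, B c -> ~ R c b.
Proof.
move=> Rirr Rtr /finite_seqP[s ->] [x0 x0s].
suff [b bs bmin] : exists2 b, b \in s & forall c, c \in s -> ~ R c b by exists b.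
have {x0 x0s} : s != [::] by move: x0s => /=; case: s.
elim: s => // x s IH _; case: s IH => [_|y s /(_ isT)[b bs bmin]].
  by exists x; rewrite ?mem_head // => c; rewrite inE => /eqP->; apply: Rirr.
have [xb|nxb] := pselect (R x b); last first.
  exists b; first by rewrite inE bs orbT.
  by move=> c; rewrite inE => /orP[/eqP->//|]; apply: bmin.
exists x; first by rewrite mem_head.
move=> c; rewrite inE => /orP[/eqP->|cs cx]; first exact: Rirr.
exact: (bmin c cs (Rtr _ _ _ cx xb)).
Qed.

Section Bridges.
Variables (G : groupType) (H : set G).
Variables (ori comp : G -> G -> Prop) (elt : G * G -> G * G -> Prop).
Hypothesis sH : subgroup H.
Hypothesis ori_mul : forall a x y, ori (a * x) (a * y) <-> ori x y.
Hypothesis ori_asym : forall x y, ori x y -> ~ ori y x.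

Definition adj x y := ori x y \/ ori y x.

Hypothesis comp_refl : forall x, comp x x.
Hypothesis comp_sym : forall x y, comp x y -> comp y x.
Hypothesis comp_trans : forall x y z, comp x y -> comp y z -> comp x z.
Hypothesis comp_mul : forall a x y, comp x y -> comp (a * x) (a * y).
Hypothesis ori_comp : forall x y, ori x y -> comp x y.
Hypothesis forest : forall (p : nat -> G) n, 0 < n ->
  (forall i, i < n -> adj (p i) (p i.+1)) ->
  (forall i, i.+1 < n -> p i.+2 <> p i) -> p n <> p 0%N.

Hypothesis elt_irr : forall e, ~ elt e e.
Hypothesis elt_trans : forall e f g, elt e f -> elt f g -> elt e g.
Hypothesis elt_total : forall e f, ori e.1 e.2 -> ori f.1 f.2 -> comp e.1 f.1 ->
  [\/ e = f, elt e f | elt f e].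

Definition eact (a : G) (e : G * G) := (a * e.1, a * e.2).
Hypothesis elt_mul : forall a e f, elt e f -> elt (eact a e) (eact a f).

(* The representative (source, target) of the unoriented edge joining x and y. *)
Definition oriented x y : G * G := if `[< ori x y >] then (x, y) else (y, x).
Definition ele e f := e = f \/ elt e f.

Lemma orientedE x y : ori x y -> oriented x y = (x, y).
Proof. by move=> xy; rewrite /oriented; case: asboolP. Qed.

Lemma adj_sym x y : adj x y -> adj y x.
Proof. by case; [right|left]. Qed.

Lemma adj_mul a x y : adj x y -> adj (a * x) (a * y).
Proof. by case=> /ori_mul h; [left|right]; apply/h. Qed.

Lemma adj_comp x y : adj x y -> comp x y.
Proof. by case=> /ori_comp // /comp_sym. Qed.

Lemma oriented_ori x y : adj x y -> ori (oriented x y).1 (oriented x y).2.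
Proof. by rewrite /oriented; case: asboolP => //= nxy [] // /nxy. Qed.

Lemma oriented_comp x y : adj x y -> comp x (oriented x y).1.
Proof. by move=> xy; rewrite /oriented; case: asboolP => //= _; exact: adj_comp. Qed.

Lemma orientedC x y : adj x y -> oriented x y = oriented y x.
Proof.
by case=> xy; rewrite (orientedE xy) /oriented; case: asboolP => // /(ori_asym xy).
Qed.

Lemma oriented_mul a x y : oriented (a * x) (a * y) = eact a (oriented x y).
Proof.
by rewrite /oriented; case: asboolP => [/ori_mul|nxy]; case: asboolP => // h; case: nxy; apply/ori_mul.
Qed.

Lemma oriented_endpoints x y z t : oriented x y = oriented z t -> (x = z /\ y = t) \/ (x = t /\ y = z).
Proof.
by rewrite /oriented; case: asboolP => _; case: asboolP => _ [-> ->]; auto.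
Qed.

Lemma oriented_total x y z t : adj x y -> adj z t -> comp x z ->
  [\/ oriented x y = oriented z t, elt (oriented x y) (oriented z t) | elt (oriented z t) (oriented x y)].
Proof.
move=> xy zt xz; apply: elt_total; [exact: oriented_ori|exact: oriented_ori|].
exact: comp_trans (comp_sym (oriented_comp xy)) (comp_trans xz (oriented_comp zt)).
Qed.

Lemma eact_mul a b e : eact (a * b) e = eact a (eact b e).
Proof. by rewrite /eact !mulgA. Qed.

Lemma eact1 e : eact 1 e = e.
Proof. by case: e => x y; rewrite /eact !mul1g. Qed.

Lemma elt_mulE a e f : elt (eact a e) (eact a f) -> elt e f.
Proof. by move/(elt_mul a^-1); rewrite -!eact_mul mulVg !eact1. Qed.

Lemma ele_trans e f g : ele e f -> ele f g -> ele e g.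
Proof.
move=> [->//|ef] [<-|fg]; first by right.
by right; apply: elt_trans fg.
Qed.

Lemma ele_mul a e f : ele e f -> ele (eact a e) (eact a f).
Proof. by move=> [->|/(elt_mul a)]; [left|right]. Qed.

Definition pedge (p : nat -> G) i := oriented (p i) (p i.+1).

Section Subforest.
Variable V : set G.

Definition ray (p : nat -> G) :=
  [/\ forall i, V (p i), forall i, adj (p i) (p i.+1) & forall i, p i.+2 <> p i].

(** The ray crosses the edge first: without backtracking in a forest, it then stays on the side of
    [y]. *)
Definition half_bridge x y := exists p, [/\ ray p, p 0%N = x, p 1%N = y &
  forall i, elt (pedge p i.+1) (oriented x y)].

Definition bridge x y := half_bridge x y /\ half_bridge y x.

Definition nonbridge x y := [/\ V x, V y, adj x y & ~ bridge x y].

Definition hasmax (e : nat -> G * G) m :=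
  exists2 j, m <= j & forall i, m <= i -> ele (e i) (e j).

(* A component of the nonbridges is a line translated by some element of H, with
   finite trees attached: it has two ends, and the condition on tails selects one
   of them. *)
Definition good (p : nat -> G) :=
  [/\ ray p, forall i, nonbridge (p i) (p i.+1) & forall m, hasmax (pedge p) m].

Lemma nonbridge_sym x y : nonbridge x y -> nonbridge y x.
Proof. by move=> [Vx Vy /adj_sym xy nb]; split=> // -[? ?]; apply: nb. Qed.

Lemma ray_inj p i j : ray p -> i < j -> p i <> p j.
Proof.
move=> [_ pa pn] ltij pij; have := @forest (fun k => p (i + k)) (j - i).
rewrite /= subnKC ?(ltnW ltij) // addn0 subn_gt0 => /(_ ltij); apply=> //.
- by move=> k _; rewrite addnS.
- by move=> k _; rewrite !addnS.
Qed.

Lemma ray_injective p : ray p -> injective p.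
Proof.
move=> rp i j pij; case: (ltngtP i j) => // ij.
  by case: (ray_inj rp ij).
by case: (ray_inj rp ij).
Qed.

Lemma ray_comp p i : ray p -> comp (p 0%N) (p i).
Proof.
move=> [_ pa _]; elim: i => [|i IH]; first exact: comp_refl.
exact: comp_trans IH (adj_comp (pa i)).
Qed.

Lemma pedge_inj p : ray p -> injective (pedge p).
Proof.
move=> rp i j /oriented_endpoints[[/(ray_injective rp)]//|[]].
by move=> /(ray_injective rp) + /(ray_injective rp); lia.
Qed.

Lemma ray_total p q i j : ray p -> ray q -> comp (p 0%N) (q 0%N) ->
  [\/ pedge p i = pedge q j, elt (pedge p i) (pedge q j) |
      elt (pedge q j) (pedge p i)].
Proof.
move=> rp rq pq; apply: oriented_total; [by case: rp|by case: rq|].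
exact: comp_trans (comp_sym (ray_comp i rp)) (comp_trans pq (ray_comp j rq)).
Qed.

(** One more edge in front can at most become the new maximum, so only far tails matter for
    goodness. *)
Lemma hasmax_prev p m : ray p -> hasmax (pedge p) m.+1 -> hasmax (pedge p) m.
Proof.
move=> rp [j ltmj jmax].
have jm i : m <= i -> i = m \/ ele (pedge p i) (pedge p j).
  by rewrite leq_eqVlt => /orP[/eqP<-|/jmax]; [left|right].
have [e|mj|jm'] := ray_total m j rp rp (comp_refl _).
- exists j => [|i /jm[->|]//]; [exact: ltnW|by left].
- exists j => [|i /jm[->|]//]; [exact: ltnW|by right].
- exists m => // i /jm[->|ij]; first by left.
  by apply: ele_trans ij _; right.
Qed.

Lemma ray_shift p k : ray p -> ray (fun i => p (i + k)).
Proof.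
by move=> [pV pa pn]; split=> i; [exact: pV|exact: (pa (i + k))|exact: (pn (i + k))].
Qed.

Lemma good_shift p : good p -> good (fun i => p i.+1).
Proof.
move=> [rp nb mx]; split=> //.
  by case: rp => pV pa pn; split.
move=> m; have [[//|j] lemj jmax] := mx m.+1.
by exists j => // i lemi; apply: jmax.
Qed.

Definition pcons (v : G) (p : nat -> G) i := if i is j.+1 then p j else v.

Lemma good_cons p v : good p -> nonbridge v (p 0%N) -> v <> p 1%N -> good (pcons v p).
Proof.
move=> [rp nb mx] vp vp1.
have rq : ray (pcons v p).
  case: rp => pV pa pn; case: vp => Vv _ av _.
  split; [by case|by case|by case=> [|i] //= /esym].
split=> // [|m]; first by case=> [|i] //; apply: nb.
have mxS m' : hasmax (pedge (pcons v p)) m'.+1.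
  have [j lemj jmax] := mx m'.
  by exists j.+1 => // -[//|i] lemi; apply: jmax.
by case: m => // ; apply: hasmax_prev.
Qed.

(** Either [v] is the second vertex of [p] and the ray is shortened, or [v] is put in front. Hence
    having a good ray is a property of a whole component of nonbridges. *)
Lemma good_step p v : good p -> nonbridge v (p 0%N) -> exists2 q, good q & q 0%N = v.
Proof.
move=> gp vp; have [e|ne] := pselect (v = p 1%N).
  by exists (fun i => p i.+1); [exact: good_shift|].
by exists (pcons v p) => //; apply: good_cons.
Qed.

Lemma good_reach p v : good p -> reach nonbridge v (p 0%N) ->
  exists2 q, good q & q 0%N = v.
Proof.
move=> gp /(reach_sym nonbridge_sym); elim=> [|x y _ [q gq qx] xy].
  by exists p.
by apply: good_step gq _; rewrite qx; apply: nonbridge_sym.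
Qed.

Definition pjoin (p q : nat -> G) n i := if i <= n then p (n - i) else q (i - n).

Lemma ray_join p q n : ray p -> ray q -> p 0%N = q 0%N -> p 1%N <> q 1%N ->
  ray (pjoin p q n).
Proof.
move=> [pV pa pn] [qV qa qn] pq0 pq1; split=> i; rewrite /pjoin.
- by case: ifP.
- case: (ltngtP i n) => [ltin|ltni|->]; rewrite ?ltnn ?subnn ?leqnn.
  + by rewrite -(subnSK ltin); apply: adj_sym.
  + by rewrite subSn //; apply: ltnW.
  + by rewrite subSnn pq0.
- case: (leqP i.+2 n) => [lein|ltni].
    have -> : i <= n by lia.
    apply/nesym.
    have -> : (n - i = (n - i.+2).+2)%N by lia.
    exact: pn.
  case: leqP => [lein|ltni2]; last first.
    have -> : (i.+2 - n = (i - n).+2)%N by lia.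
    exact: qn.
  have [->|->] : i = n \/ n = i.+1 by lia.
    rewrite subnn pq0; have -> : (n.+2 - n = 2)%N by lia.
    exact: qn.
  by rewrite subSnn subSn // subnn => /esym.
Qed.

(* Following p backwards from its largest edge and then q, one gets a ray with
   smaller edges on the other side of that edge, which is therefore a bridge. *)
Lemma good_branch p q j : good p -> good q -> p 0%N = q 0%N -> p 1%N <> q 1%N ->
  (forall i, ele (pedge p i) (pedge p j)) ->
  (forall i, ele (pedge q i) (pedge p j)) -> False.
Proof.
move=> [rp nbp _] [rq _ _] pq0 pq1 pmax qmax; case: (nbp j) => _ _ apj; apply.
split.
  exists (fun i => p (i + j)); split=> //; first exact: ray_shift.
  move=> i; have [/(pedge_inj rp)|//] := pmax (i.+1 + j); lia.
have rr := ray_join j.+1 rp rq pq0 pq1; exists (pjoin p q j.+1).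
have r0 : pedge (pjoin p q j.+1) 0 = pedge p j.
  by rewrite /pedge /pjoin /= subn0 subSS subn0; apply: orientedC (adj_sym _).
split=> //; rewrite ?/pjoin ?subSS ?subn0 //.
move=> i; rewrite -orientedC // -[oriented (p j) _]/(pedge p j) -[X in elt _ X]r0.
suff [] : ele (pedge (pjoin p q j.+1) i.+1) (pedge p j).
- by rewrite -{1}r0 => /(pedge_inj rr).
- by rewrite r0.
rewrite {1}/pedge /pjoin; case: (ltngtP i j) => [ltij|ltji|->].
- rewrite !ltnS ltij (ltnW ltij) !subSS -(subnSK ltij) orientedC; first exact: pmax.
  by apply: adj_sym; case: rp.
- have -> : (i.+1 <= j.+1) = false by lia.
  have -> : (i.+2 <= j.+1) = false by lia.
  by rewrite !subSS subSn ?(ltnW ltji) //; apply: qmax.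
- by rewrite leqnn ltnn subnn subSnn pq0; apply: qmax.
Qed.

(** If the rays parted at once, the larger of their two maximal edges would be a bridge by
    [good_branch], but good rays contain none. *)
Lemma good_unique p q : good p -> good q -> p 0%N = q 0%N -> p 1%N = q 1%N.
Proof.
move=> gp gq pq0; apply: contrapT => pq1.
case: (gp) => rp _ /(_ 0%N)[j _ pmax]; case: (gq) => rq _ /(_ 0%N)[k _ qmax].
have cpq : comp (p 0%N) (q 0%N) by rewrite pq0.
have [e|jk|kj] := ray_total j k rp rq cpq.
- apply: (good_branch (j := j) gp gq pq0 pq1) => i; first exact: pmax.
  by rewrite e; apply: qmax.
- apply: (good_branch (j := k) gq gp (esym pq0) (nesym pq1)) => i; first exact: qmax.
  by apply: ele_trans (pmax i _) _ => //; right.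
- apply: (good_branch (j := j) gp gq pq0 pq1) => i; first exact: pmax.
  by apply: ele_trans (qmax i _) _ => //; right.
Qed.

Hypothesis V_mul : forall a x, H a -> V x -> V (a * x).

Lemma ray_mul a p : H a -> ray p -> ray (fun i => a * p i).
Proof.
move=> Ha [pV pa pn]; split=> i; [exact: V_mul|exact: adj_mul|].
by move=> /mulgI; apply: pn.
Qed.

Lemma half_bridge_mul a x y : H a -> half_bridge x y -> half_bridge (a * x) (a * y).
Proof.
move=> Ha [p [rp <- <- pl]]; exists (fun i => a * p i); split=> //.
  exact: ray_mul.
by move=> i; rewrite /pedge !oriented_mul; apply/elt_mul/pl.
Qed.

Lemma bridge_mul a x y : H a -> bridge x y -> bridge (a * x) (a * y).
Proof. by move=> Ha [? ?]; split; apply: half_bridge_mul. Qed.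

Lemma bridge_mulE a x y : H a -> bridge (a * x) (a * y) -> bridge x y.
Proof.
by move=> Ha /(bridge_mul (subgroupV sH Ha)); rewrite !mulKg.
Qed.

Lemma nonbridge_mul a x y : H a -> nonbridge x y -> nonbridge (a * x) (a * y).
Proof.
move=> Ha [Vx Vy xy nb]; split; [exact: V_mul|exact: V_mul|exact: adj_mul|].
by move=> /(bridge_mulE Ha).
Qed.

Lemma good_mul a p : H a -> good p -> good (fun i => a * p i).
Proof.
move=> Ha [rp nb mx]; split; first exact: ray_mul.
  by move=> i; apply: nonbridge_mul.
move=> m; have [j lemj jmax] := mx m; exists j => // i lemi.
by rewrite /pedge !oriented_mul; apply/ele_mul/jmax.
Qed.

(** * Periodic rays spanned by a translation *)

Section Axis.
Variables (a : G) (p : nat -> G) (n : nat).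
Hypotheses (Ha : H a) (n_gt0 : 0 < n) (pna : p n = a * p 0%N).
Hypothesis p_nb : forall i, i < n -> nonbridge (p i) (p i.+1).
Hypothesis p_red : forall i, i.+1 < n -> p i.+2 <> p i.
Hypothesis p_join : a * p 1%N <> p n.-1.

Definition axis i := a ^+ (i %/ n) * p (i %% n).

Lemma H_expgn k : H (a ^+ k).
Proof.
elim: k => [|k IH]; first exact: subgroup1.
by rewrite expgS; apply: subgroupM.
Qed.

(** The bound [r <= n] includes the junction, which is the end of one period and the start of the
    next; so both ends of an edge can be read in the same period. *)
Lemma axisE q r : r <= n -> axis (q * n + r) = a ^+ q * p r.
Proof.
rewrite leq_eqVlt => /orP[/eqP->|ltrn].
  by rewrite -mulSnr /axis mulnK // modnMl expgSr -mulgA pna.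
by rewrite /axis divnMDl // divn_small // addn0 modnMDl modn_small.
Qed.

Lemma axis_index i : exists q r, i = (q * n + r)%N /\ r < n.
Proof. by exists (i %/ n), (i %% n); rewrite -divn_eq ltn_mod. Qed.

Lemma axis_edge q r : r < n -> pedge axis (q * n + r) = eact (a ^+ q) (pedge p r).
Proof.
by move=> ltrn; rewrite /pedge -addnS !axisE // ?oriented_mul //; apply: ltnW.
Qed.

Lemma axis_nonbridge i : nonbridge (axis i) (axis i.+1).
Proof.
have [q [r [-> ltrn]]] := axis_index i.
rewrite -addnS !axisE // ?(ltnW ltrn) //.
by apply: nonbridge_mul; [exact: H_expgn|exact: p_nb].
Qed.

Lemma axis_ray : ray axis.
Proof.
split=> [i|i|i]; [by case: (axis_nonbridge i)|by case: (axis_nonbridge i)|].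
have [q [r [-> ltrn]]] := axis_index i.
have [ltrn1|lenr] := ltnP r.+1 n.
  have lern := ltnW ltrn; rewrite -!addnS !axisE //.
  by move/mulgI; apply: p_red.
have er : r.+1 = n by lia.
have -> : (q * n + r).+2 = (q.+1 * n + 1)%N by rewrite mulSn -er; lia.
have lern := ltnW ltrn; rewrite !axisE //.
rewrite expgSr -mulgA => /mulgI; have -> : r = n.-1 by lia.
exact: p_join.
Qed.

(** Each translation by [a] lowers the maximum of a period, so from index [m * n] on the largest
    edge is the one at [m * n + j]. [hasmax_prev] then brings the start down to any [m]. *)
Lemma axis_good j : j < n ->
  (forall i, i < n -> ele (pedge p i) (pedge p j)) ->
  elt (eact a (pedge p j)) (pedge p j) -> good axis.
Proof.
move=> ltjn jmax aj; split; [exact: axis_ray|exact: axis_nonbridge|move=> m].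
have : hasmax (pedge axis) (m * n).
  exists (m * n + j)%N; first exact: leq_addr.
  move=> i; have [q [r [-> ltrn]]] := axis_index i => lemq.
  rewrite !axis_edge //; apply: ele_trans (ele_mul _ (jmax _ ltrn)) _.
  have leqm : m <= q.
    by rewrite -ltnS -(ltn_pmul2r n_gt0) mulSn; lia.
  rewrite -(subnKC leqm); elim: (q - m)%N => [|k IH]; first by rewrite addn0; left.
  rewrite addnS; apply: ele_trans _ IH; right.
  by rewrite expgSr eact_mul; apply: elt_mul.
have : m <= m * n by rewrite leq_pmulr.
elim: (m * n)%N => [|k IH]; first by rewrite leqn0 => /eqP->.
rewrite leq_eqVlt => /orP[/eqP->//|ltmk].
by move/(hasmax_prev axis_ray); apply: IH.
Qed.

End Axis.

Lemma walk_max p n : 0 < n -> (forall i, i < n -> adj (p i) (p i.+1)) ->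
  exists2 j, j < n & forall i, i < n -> ele (pedge p i) (pedge p j).
Proof.
case: n => // n _ pa.
have pc i : i < n.+1 -> comp (p 0%N) (p i).
  elim: i => [|i IH] ltin; first exact: comp_refl.
  exact: comp_trans (IH (ltnW ltin)) (adj_comp (pa _ (ltnW ltin))).
elim: n pa pc => [|n IH] pa pc.
  by exists 0%N => // -[|i] // _; left.
have [|i ltin|j ltjn jmax] := IH; first by move=> i ltin; apply: pa; apply: ltnW.
  by apply: pc; apply: ltnW.
have cj : comp (p n.+1) (p j).
  by apply: comp_trans (comp_sym (pc _ _)) (pc _ _) => //; apply: ltnW.
have key i : i < n.+2 -> i = n.+1 \/ ele (pedge p i) (pedge p j).
  by rewrite ltnS leq_eqVlt => /orP[/eqP->|/jmax]; [left|right].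
have [e|nj|jn] := oriented_total (pa n.+1 (ltnSn _)) (pa j (ltnW ltjn)) cj.
- by exists j => [|i /key[->|//]]; [exact: ltnW|left].
- by exists j => [|i /key[->|//]]; [exact: ltnW|right].
- exists n.+1 => // i /key[->|ij]; first by left.
  by apply: ele_trans ij _; right.
Qed.

(* The largest edge of a period is moved down by a or by its inverse; the axis is
   good in that direction. *)
Lemma axis_exists_good a p n : H a -> 0 < n -> p n = a * p 0%N ->
  (forall i, i < n -> nonbridge (p i) (p i.+1)) ->
  (forall i, i.+1 < n -> p i.+2 <> p i) -> a * p 1%N <> p n.-1 ->
  a != 1 -> exists2 q, good q & q 0%N = p 0%N.
Proof.
move=> Ha n0 pna pnb pred pjoin a1.
have pa i : i < n -> adj (p i) (p i.+1) by move=> /pnb[].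
have [j ltjn jmax] := walk_max n0 pa.
have cpj : comp (p j) (a * p j).
  have c0 : comp (p 0%N) (p j).
    elim: j ltjn {jmax} => [|j IH] ltjn; first exact: comp_refl.
    exact: comp_trans (IH (ltnW ltjn)) (adj_comp (pa _ (ltnW ltjn))).
  have cn : comp (p 0%N) (p n).
    case: {pna pnb pred pjoin jmax ltjn} n n0 pa => // n _.
    elim: n => [|n IH] pa; first exact: adj_comp (pa _ _).
    apply: comp_trans (IH _) (adj_comp (pa _ _)) => // i lti.
    by apply: pa; apply: ltnW.
  rewrite pna in cn.
  exact: comp_trans (comp_sym c0) (comp_trans cn (comp_mul _ c0)).
have aaj : adj (a * p j) (a * p j.+1) by apply: adj_mul; apply: pa.
have := oriented_total (pa j ltjn) aaj cpj; rewrite oriented_mul -/(pedge p j).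
case=> [e|ja|aj]; last 1 first.
- exists (axis a p n); first exact: axis_good aj.
  by rewrite /axis div0n mod0n mul1g.
- by case: (pedge p j) e => x y [/esym/eqP]; rewrite -{2}[x]mul1g (inj_eq (mulIg _)) (negPf a1).
pose b := a^-1; have Hb : H b by apply: subgroupV.
(* The period read backwards, translated so as to start again at [p 0]; its largest edge now has
   index [n - j.+1]. *)
pose r i := b * p (n - i).
have r0 : r 0%N = p 0%N by rewrite /r subn0 pna mulKg.
have redge i : i < n -> pedge r i = eact b (pedge p (n - i.+1)).
  move=> ltin; rewrite /pedge /r oriented_mul subnSK // orientedC //.
  by rewrite -(subnSK ltin); apply/adj_sym/pa; lia.
have rn : r n = b * r 0%N by rewrite r0 /r subnn.
exists (axis b r n); last by rewrite /axis div0n mod0n mul1g.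
apply: (axis_good Hb n0 rn _ _ _ (j := n - j.+1)).
- move=> i ltin; rewrite /r -(subnSK ltin); apply/nonbridge_mul/nonbridge_sym/pnb => //.
  lia.
- move=> i ltin; rewrite /r => /mulgI.
  have -> : (n - i = (n - i.+2).+2)%N by lia.
  by move/esym; apply: pred; lia.
- rewrite /r => /mulgI /(congr1 (mul a)); rewrite mulVKg.
  have -> : (n - n.-1 = 1)%N by lia.
  by rewrite subn1 => /esym.
- lia.
- move=> i ltin; rewrite !redge //; last by lia.
  have -> : (n - (n - j.+1).+1 = j)%N by lia.
  by apply/ele_mul/jmax; lia.
- rewrite redge; last by lia.
  have -> : (n - (n - j.+1).+1 = j)%N by lia.
  by apply: elt_mul; apply: (@elt_mulE a); rewrite -eact_mul mulgV eact1.
Qed.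

(* A shortest path among those joining some y to a * y in the component of x spans
   an axis of a. *)
Lemma good_of_translation x a : H a -> a != 1 -> reach nonbridge x (a * x) ->
  exists2 q, good q & q 0%N = x.
Proof.
move=> Ha a1 rx; have [n0 [p0 [p00 p0n p0nb]]] := reach_walk rx.
pose Q n := exists p, [/\ reach nonbridge x (p 0%N), p n = a * p 0%N &
  forall i, i < n -> nonbridge (p i) (p i.+1)].
have exQ : exists n, `[< Q n >].
  exists n0; apply/asboolP; exists p0; split=> //; last by rewrite p00.
  by rewrite p00; apply: reach_refl.
have [n /asboolP[p [xp pn pnb]] nmin] := ex_minnP exQ.
suff [q gq q0] : exists2 q, good q & q 0%N = p 0%N.
  by apply: (good_reach gq); rewrite q0.
have n_gt0 : 0 < n.
  case: n pn {pnb nmin} => // /eqP; rewrite -{1}[p 0%N]mul1g (inj_eq (mulIg _)).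
  by rewrite eq_sym (negPf a1).
have noQ m : m < n -> ~ Q m.
  by move=> ltmn /asboolT /nmin; lia.
apply: (axis_exists_good Ha n_gt0 pn pnb) => // [i ltin pii|ap].
  apply: (noQ (n - 2)%N); first by lia.
  exists (fun k => if k <= i then p k else p k.+2); split=> //.
    case: leqP => [leni|_]; last by rewrite -pn; congr p; lia.
    have -> : (n - 2 = i)%N by lia.
    by rewrite -pii -pn; congr p; lia.
  move=> k ltkn; case: (ltngtP k i) => [ltki|ltik|ki].
  - by apply: pnb; lia.
  - by apply: pnb; lia.
  - by rewrite ki -pii; apply: pnb; lia.
case: (ltngtP n 1%N) => [|lt1n|e]; first by lia.
  apply: (noQ (n - 2)%N); first by lia.
  exists (fun k => p k.+1); split; first by apply: reach_step xp (pnb _ _).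
    by rewrite ap; congr p; lia.
  by move=> i ltin; apply: pnb; lia.
(* With a period of one edge, [a] would exchange its two ends and so reverse its orientation. *)
have [_ _ xy _] := pnb 0%N n_gt0.
have p1 : p 1%N = a * p 0%N by rewrite -pn e.
have p0' : p 0%N = a * p 1%N by rewrite ap e.
by case: xy => h; have := (ori_mul a _ _).2 h; rewrite -p1 -p0'; apply: ori_asym.
Qed.

Hypothesis V_cofinite : exists2 U, finite_set U &
  forall x, V x -> exists a u, [/\ H a, U u & x = a * u].
Hypothesis V_locally_finite : forall x, V x -> finite_set [set y | V y /\ adj x y].
Hypothesis V_connected : forall x y, V x -> V y -> comp x y ->
  reach (fun x y => [/\ V x, V y & adj x y]) x y.
Hypothesis V_periodic : forall x, V x -> exists y a,
  [/\ V y, comp x y, H a, a != 1 & comp y (a * y)].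

(* If the component D of x had no translation, it would be finite; the ray starting
   at its smallest boundary edge, which is a bridge, would then have to leave D
   through a smaller boundary edge. *)
Lemma component_translation x : V x -> exists y a,
  [/\ reach nonbridge x y, H a, a != 1 & reach nonbridge y (a * y)].
Proof.
move=> Vx; apply: contrapT => noper.
pose D : set G := [set y | reach nonbridge x y].
have DV y : D y -> V y by case=> // ? ? _ [].
have Dx : D x by apply: reach_refl.
have Dper y a : H a -> D y -> D (a * y) -> a = 1.
  move=> Ha Dy Day; apply: contrapT => /eqP a1; apply: noper.
  exists y, a; split=> //; apply: reach_trans Day.
  exact: reach_sym nonbridge_sym Dy.
have finD : finite_set D.
  have [U finU VU] := V_cofinite.
  pose f y := xget 1 [set u | U u /\ exists2 a, H a & y = a * u].
  have fP y : D y -> U (f y) /\ exists2 a, H a & y = a * f y.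
    move=> /DV /VU[a [u [Ha Uu e]]].
    by apply: (@xgetI _ 1 [set u | U u /\ exists2 a, H a & y = a * u] u); split=> //; exists a.
  (* Two points with the same representative differ by a translation of [D]; so [D] embeds into the
     finite set [U]. *)
  have finj : {in D &, injective f}.
    move=> y z /set_mem Dy /set_mem Dz fyz.
    have [_ [a Ha ea]] := fP y Dy; have [_ [b Hb eb]] := fP z Dz.
    have e : y = (a * b^-1) * z by rewrite {1}ea fyz {2}eb mulgA mulgVK.
    have Hab : H (a * b^-1) by apply: subgroupM => //; apply: subgroupV.
    by rewrite e (Dper z _ Hab Dz) ?mul1g // -e.
  have := inj_card_eq finj => /eq_finite_set <-.
  by apply: sub_finite_set finU => _ [y /fP[Uy _] <-].
pose B := [set e : G * G | [/\ D e.1, ~ D e.2, V e.2 & adj e.1 e.2]].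
have finB : finite_set B.
  apply: (@sub_finite_set _ _ (D `*`` (fun y => [set z | V z /\ adj y z]))).
    by move=> [y z] [/= Dy _ Vz yz]; split.
  by apply: finite_setXR => // y Dy; apply: V_locally_finite; apply: DV.
(* [D] cannot fill its tree in [V], where [V_periodic] provides a translation; a path leaving [D]
   yields a boundary edge. *)
have B0 : B !=set0.
  have [y [a [Vy xy Ha a1 ya]]] := V_periodic Vx.
  have [u [Vu xu nDu]] : exists u, [/\ V u, comp x u & ~ D u].
    have [Dy|nDy] := pselect (D y); last by exists y.
    exists (a * y); split; [exact: V_mul|exact: comp_trans ya|].
    by move=> Day; move: a1; rewrite (Dper y a) // eqxx.
  have [v [w [[Vv Vw vw] Dv nDw]]] := reach_exit Dx nDu (V_connected Vx Vu xu).
  by exists (v, w).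
have [[y z] [/= Dy nDz Vz yz] Bmin] := finite_set_minimal
  (R := fun e f => elt (oriented e.1 e.2) (oriented f.1 f.2))
  (fun e => @elt_irr _) (fun e f g => @elt_trans _ _ _) finB B0.
have [_ [p [rp pz py pl]]] : bridge y z.
  by apply: contrapT => nb; apply: nDz; apply: (reach_step Dy); split=> //; exact: DV.
have [i [Di nDi]] : exists i, D (p i.+1) /\ ~ D (p i.+2).
  apply: contrapT => noexit.
  have pD i : D (p i.+1).
    elim: i => [|i IH]; first by rewrite py.
    by apply: contrapT => nDi; apply: noexit; exists i.
  apply: infinite_nat; have pinj : {in setT &, injective (fun i => p i.+1)}.
    by move=> i j _ _ /(ray_injective rp)[].
  have := inj_card_eq pinj => /eq_finite_set <-.
  by apply: sub_finite_set finD => _ [i _ <-]; apply: pD.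
case: (rp) => pV pa _.
apply: (Bmin (p i.+1, p i.+2)); first by split; [| |exact: pV|exact: pa].
by rewrite /= [oriented y z]orientedC //; apply: pl.
Qed.

Lemma good_exists x : V x -> exists2 p, good p & p 0%N = x.
Proof.
move=> /component_translation[y [a [xy Ha a1 ya]]].
have [p gp py] := good_of_translation Ha a1 ya.
by apply: (good_reach gp); rewrite py.
Qed.

Theorem nonbridge_matching : exists nxt : G -> G,
  [/\ forall x, V x -> nonbridge x (nxt x),
      forall x, V x -> nxt (nxt x) <> x,
      forall x y, nonbridge x y -> nxt x = y \/ nxt y = x &
      forall a x, H a -> V x -> nxt (a * x) = a * nxt x].
Proof.
pose nxt x := xget 1 [set y | exists p, [/\ good p, p 0%N = x & p 1%N = y]].
have nxtP x : V x -> exists p, [/\ good p, p 0%N = x & p 1%N = nxt x].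
  move=> /good_exists[p gp px].
  apply: (@xgetI _ 1 [set y | exists p, [/\ good p, p 0%N = x & p 1%N = y]] (p 1%N)).
  by exists p.
have nxtE p : good p -> nxt (p 0%N) = p 1%N.
  move=> gp; have Vp : V (p 0%N) by case: gp => -[].
  have [q [gq q0 <-]] := nxtP _ Vp.
  by apply: good_unique.
exists nxt; split.
- by move=> x /nxtP[p [[_ nb _] <- <-]].
- move=> x /nxtP[p [gp <- <-]]; rewrite (nxtE _ (good_shift gp)).
  by case: gp => -[_ _ pn] _ _; apply: pn.
- move=> x y xy; have Vx : V x by case: xy.
  have [p [gp px p1]] := nxtP x Vx.
  have [<-|py] := pselect (p 1%N = y); [by left|right].
  rewrite -px in xy.
  have := nxtE _ (good_cons gp (nonbridge_sym xy) (nesym py)).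
  by rewrite /= px.
- move=> a x Ha /nxtP[p [gp <- <-]].
  exact: (nxtE _ (good_mul Ha gp)).
Qed.

End Subforest.
End Bridges.

(** * Counting orbits of vertices and edges *)

Lemma leq_card_rel (I K : finType) (P : I -> K -> Prop) :
  (forall i, exists k, P i k) -> (forall i j k, P i k -> P j k -> i = j) ->
  #|I| <= #|K|.
Proof.
move=> /choice[f fP] Pinj; apply: (@leq_card _ _ f) => i j e.
by apply: (Pinj _ _ (f i)) => //; rewrite e.
Qed.

Section Transversals.
Variables (G : groupType) (H : set G) (T : choiceType) (act : G -> T -> T).
Hypothesis sH : subgroup H.
Hypothesis act1 : forall t, act 1 t = t.
Hypothesis actM : forall a b t, act (a * b) t = act a (act b t).

Definition orbit_transversal (S : set T) m (r : 'I_m -> T) :=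
  [/\ forall i, S (r i),
      forall t, S t -> exists i a, H a /\ t = act a (r i) &
      forall i j a, H a -> r i = act a (r j) -> i = j].

Definition orbit_equiv t u := exists2 a, H a & t = act a u.

Lemma orbit_equiv_sym t u : orbit_equiv t u -> orbit_equiv u t.
Proof.
move=> [a Ha ->]; exists a^-1; first exact: subgroupV.
by rewrite -actM mulVg act1.
Qed.

Lemma orbit_equiv_trans t u v : orbit_equiv t u -> orbit_equiv u v -> orbit_equiv t v.
Proof.
move=> [a Ha ->] [b Hb ->]; exists (a * b); first exact: subgroupM.
by rewrite actM.
Qed.

(** In a list of the elements of [U], the first one equivalent to [t] depends only on the orbit of
    [t]; it is taken as representative. *)
Lemma transversal_exists (S U : set T) :
  (forall a t, H a -> S t -> S (act a t)) -> finite_set U ->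
  (forall t, S t -> exists2 u, U u & orbit_equiv t u) ->
  exists m (r : 'I_m -> T), orbit_transversal S r.
Proof.
move=> Sact /finite_seqP[s ->] Ss.
pose rep t := nth t s (find (fun u => `[< orbit_equiv t u >]) s).
have has_rep t : S t -> has (fun u => `[< orbit_equiv t u >]) s.
  by move=> /Ss[u us tu]; apply/hasP; exists u => //; apply/asboolP.
have rep_equiv t : S t -> orbit_equiv t (rep t).
  by move=> /has_rep ht; apply/asboolP; have := nth_find t ht.
have rep_s t : S t -> rep t \in s.
  by move=> /has_rep ht; rewrite mem_nth // -has_find.
have rep_eq t u : S t -> S u -> orbit_equiv t u -> rep t = rep u.
  move=> St Su tu; rewrite /rep.
  have -> : find (fun v => `[< orbit_equiv t v >]) s =
            find (fun v => `[< orbit_equiv u v >]) s.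
    apply: eq_find => v; apply: asbool_equiv_eq; split=> [tv|uv].
      exact: orbit_equiv_trans (orbit_equiv_sym tu) tv.
    exact: orbit_equiv_trans tu uv.
  by apply: set_nth_default; rewrite -has_find; apply: has_rep.
have S_rep t : S t -> S (rep t).
  by move=> St; have [a Ha ->] := orbit_equiv_sym (rep_equiv _ St); apply: Sact.
pose R := undup [seq rep u | u <- s & `[< S u >]].
have inR t : S t -> rep t \in R.
  move=> St; rewrite mem_undup; apply/mapP; exists (rep t).
    by rewrite mem_filter rep_s // andbT; apply/asboolP/S_rep.
  by apply: rep_eq => //; [exact: S_rep|exact: rep_equiv].
have RP t : t \in R -> S t /\ rep t = t.
  rewrite mem_undup => /mapP[u]; rewrite mem_filter => /andP[/asboolP Su _] ->.
  split; first exact: S_rep.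
  apply: rep_eq => //; [exact: S_rep|exact/orbit_equiv_sym/rep_equiv].
exists (size R), (tnth (in_tuple R)); split.
- by move=> i; have [] := RP _ (mem_tnth i (in_tuple R)).
- move=> t St; have [a Ha ea] := rep_equiv _ St.
  have /tnthP[i ei] : rep t \in in_tuple R by apply: inR.
  by exists i, a; rewrite -ei.
- move=> i j a Ha e.
  have [Si ri] := RP _ (mem_tnth i (in_tuple R)).
  have [Sj rj] := RP _ (mem_tnth j (in_tuple R)).
  suff : tnth (in_tuple R) i = tnth (in_tuple R) j.
    by apply/tuple_uniqP; rewrite /= undup_uniq.
  by rewrite -ri -rj; apply: rep_eq => //; exists a.
Qed.

End Transversals.

(** * Euler characteristic of a quotient forest, by counting functions to F_2 *)

Section EulerCharacteristic.
Variables (G : groupType) (H X F W : set G) (n : nat).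
Variables (coset : G -> 'I_n) (base : 'I_n -> G) (V : set G).
Hypotheses (sH : subgroup H) (HX : free_basis H X).
Hypotheses (sF : subgroup F) (FW : free_basis F W).
Hypothesis cosetP : forall x y, coset x = coset y <-> F (x^-1 * y).
Hypothesis coset_base : forall i, coset (base i) = i.
Hypothesis V_base : forall i, V (base i).
Hypothesis V_mul : forall a x, H a -> V x -> V (a * x).
Hypothesis V_connected : forall x y, V x -> V y -> coset x = coset y ->
  reach (fun x y => [/\ V x, V y & W (x^-1 * y) \/ W (y^-1 * x)]) x y.

Definition edges : set (G * G) := [set e | [/\ V e.1, V e.2 & W (e.1^-1 * e.2)]].

Variables (mV mE : nat) (vs : 'I_mV -> G) (es : 'I_mE -> G * G).
Hypothesis vsP : orbit_transversal H mul V vs.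
Hypothesis esP : orbit_transversal H (@eact G) edges es.

(* Modulo values outside V, these functions form a vector space over F_2.  The
   values of the coboundary on E/H together with the values at the base points
   are coordinates on it; so are the values on V/H together with the increments
   under the basis of H at the base points.  Comparing dimensions gives
   mE + n = r * n + mV. *)
Definition quasi_invariant (f : G -> bool) := forall a x y,
  H a -> V x -> V y -> coset x = coset y -> f (a * x) (+) f x = f (a * y) (+) f y.

Lemma coset_mul a x y : coset x = coset y -> coset (a * x) = coset (a * y).
Proof. by move=> /cosetP xy; apply/cosetP; rewrite invgM mulgA mulgVK. Qed.

Lemma F_coset x f : F f -> coset (x * f) = coset x.
Proof.
move=> Ff; apply/cosetP; rewrite invgM mulgVK.
exact: subgroupV.
Qed.

Lemma quasi_invariant_edge f a x y : quasi_invariant f -> H a ->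
  V x -> V y -> W (x^-1 * y) -> f (a * x) (+) f (a * y) = f x (+) f y.
Proof.
move=> qf Ha Vx Vy /(basis_sub FW) /cosetP xy.
have := qf a x y Ha Vx Vy xy.
by case: (f (a * x)); case: (f (a * y)); case: (f x); case: (f y).
Qed.

(** Quasi-invariance spreads equality of coboundaries from [es] to all edges of [V]; connectedness
    integrates it from the base points. *)
Lemma eq_of_edges f g : quasi_invariant f -> quasi_invariant g ->
  (forall i, f (es i).1 (+) f (es i).2 = g (es i).1 (+) g (es i).2) ->
  (forall i, f (base i) = g (base i)) -> forall x, V x -> f x = g x.
Proof.
move=> qf qg efg bfg x Vx; have [esE esS _] := esP.
have fgE y z : V y -> V z -> W (y^-1 * z) -> f y (+) f z = g y (+) g z.
  move=> Vy Vz yz; have [|i [a [Ha e]]] := esS (y, z); first by [].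
  have [Vi1 Vi2 Wi] := esE i; case: e => -> ->.
  by rewrite (quasi_invariant_edge qf Ha) // (quasi_invariant_edge qg Ha).
have := V_connected (V_base (coset x)) Vx (coset_base _).
elim=> [|y z _ IH [Vy Vz [yz|zy]]]; first exact: bfg.
  by have := fgE _ _ Vy Vz yz; rewrite IH => /addbI.
by have := fgE _ _ Vz Vy zy; rewrite IH => /addIb.
Qed.

Lemma exists_of_edges (d : 'I_mE -> bool) (b : 'I_n -> bool) : exists f,
  [/\ quasi_invariant f, forall i, f (es i).1 (+) f (es i).2 = d i &
      forall i, f (base i) = b i].
Proof.
have [esE _ es_inj] := esP.
(* The equivariant extension of [d], zero off the orbits of the [es i]. *)
pose dl x y := `[< exists i a, [/\ H a, (x, y) = eact a (es i) & d i] >].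
have dl_mul a x y : H a -> dl (a * x) (a * y) = dl x y.
  move=> Ha; apply: asbool_equiv_eq; split=> -[i [c [Hc e di]]].
    exists i, (a^-1 * c); split=> //; first by apply: subgroupM => //; apply: subgroupV.
    by rewrite eact_mul -e /eact /= !mulKg.
  exists i, (a * c); split=> //; first exact: subgroupM.
  by rewrite eact_mul -e.
have dl_es i : dl (es i).1 (es i).2 = d i.
  apply/asboolP/idP => [[j [a [Ha e dj]]]|di].
    by rewrite (es_inj i j a Ha) // -e; case: (es i).
  exists i, 1; split=> //; first exact: subgroup1.
  by rewrite eact1; case: (es i).
pose de x (l : G * bool) := if l.2 then dl (x * letter l) x else dl x (x * letter l).
pose pw := fix pw x w := if w is l :: w' then de x l (+) pw (x * letter l) w' else false.
(* The integral of [dl] along the path from [x] to the base point of its coset. As [dl] is defined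
   on all pairs, whether the path stays in [V] need not be checked. *)
pose f x := pw x (fword W (x^-1 * base (coset x))) (+) b (coset x).
have de_linv x l : de (x * letter l) (linv l) = de x l.
  by rewrite /de letter_linv mulgK; case: l => z [].
have f_step x l : W l.1 -> f x = de x l (+) f (x * letter l).
  move=> Wl; rewrite /f.
  have Fl : F (letter l) := letter_in sF (basis_sub FW) Wl.
  rewrite F_coset //; set z := base _; set y := x * letter l.
  have Fy : F (y^-1 * z).
    by apply/cosetP; rewrite coset_base F_coset.
  have -> : x^-1 * z = letter l * (y^-1 * z) by rewrite /y invgM !mulgA mulgV mul1g.
  have [->|->] := fword_cons sF FW Wl Fy; first by rewrite /= addbA.
  by rewrite /= de_linv /y letter_linv mulgK !addbA addbb.
have f_edge x y : W (x^-1 * y) -> f x (+) f y = dl x y.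
  move=> Wxy; rewrite (f_step x (x^-1 * y, false)) // /de /letter /= mulVKg.
  by rewrite -addbA addbb addbF.
exists f; split=> [a x y Ha Vx Vy xy|i|i].
- elim: (V_connected Vx Vy xy) => // y1 y2 _ -> [_ _ y12].
  have E u v : W (u^-1 * v) -> f (a * u) (+) f u = f (a * v) (+) f v.
    move=> uv; have := f_edge _ _ uv.
    have auv : W ((a * u)^-1 * (a * v)) by rewrite invgM mulgA mulgVK.
    have := f_edge _ _ auv; rewrite dl_mul // => <-.
    by case: (f (a * u)); case: (f (a * v)); case: (f u); case: (f v).
  by case: y12 => /E.
- by rewrite f_edge //; case: (esE i).
- by rewrite /f coset_base mulVg (fword1 sF FW).
Qed.

(** The increments of [f + g] under [X] vanish at the base points, hence on [V] by quasi-invariance.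
    So [f + g] is [H]-invariant on [V], and it vanishes on representatives. *)
Lemma eq_of_generators f g : quasi_invariant f -> quasi_invariant g ->
  (forall i, f (vs i) = g (vs i)) ->
  (forall x i, X x ->
     f (x * base i) (+) f (base i) = g (x * base i) (+) g (base i)) ->
  forall x, V x -> f x = g x.
Proof.
move=> qf qg vfg xfg; have [vsV vsS _] := vsP.
pose t x := f x (+) g x.
have tX x y : X x -> V y -> t (x * y) = t y.
  move=> Xx Vy; have Hx := basis_sub HX Xx.
  have := qf x y _ Hx Vy (V_base (coset y)) (esym (coset_base _)).
  have := qg x y _ Hx Vy (V_base (coset y)) (esym (coset_base _)).
  rewrite -xfg // => <-; rewrite /t.
  by case: (f (x * y)); case: (g (x * y)); case: (f y); case: (g y).
have tH : forall a, H a -> forall y, V y -> t (a * y) = t y.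
  apply: (basis_ind sH HX) => [y _|l h Xl Hh IH y Vy]; first by rewrite mul1g.
  rewrite -mulgA -[RHS]IH //; move: (V_mul Hh Vy); move: (h * y) => z Vz.
  rewrite /letter; case: l.2; last exact: tX.
  have Hl : H l.1^-1 := subgroupV sH (basis_sub HX Xl).
  by have := tX l.1 (l.1^-1 * z) Xl (V_mul Hl Vz); rewrite mulVKg.
move=> x Vx; have [i [a [Ha ->]]] := vsS x Vx.
have := tH a Ha (vs i) (vsV i); rewrite /t vfg addbb.
by case: (f _); case: (g _).
Qed.

(** Because [H] is free on [X], increments prescribed on generators extend to a cocycle [c] on [H]
    with values in functions on the cosets. Left multiplication being free, [c] and the values on
    representatives define [f] without conflict. *)
Lemma exists_of_generators (phi : G -> 'I_n -> bool) (psi : 'I_mV -> bool) : exists f,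
  [/\ quasi_invariant f, forall i, f (vs i) = psi i &
      forall x i, X x -> f (x * base i) (+) f (base i) = phi x i].
Proof.
have [vsV vsS vs_inj] := vsP.
pose ix a i := coset (a * base i).
have ixM a b i : ix (a * b) i = ix a (ix b i).
  by rewrite /ix -mulgA; apply: coset_mul; rewrite coset_base.
have ixV a x : ix a (coset x) = coset (a * x).
  by apply: coset_mul; rewrite coset_base.
have ix1 i : ix 1 i = i by rewrite /ix mul1g coset_base.
(* An inverse letter undoes the increment of its generator at the coset it leads to; the sign is
   lost modulo 2. *)
pose cl (l : G * bool) i := if l.2 then phi l.1 (ix (letter l) i) else phi l.1 i.
pose cw := fix cw w i := if w is l :: w' then cl l (ix (word_value w') i) (+) cw w' i
                         else false.
pose c a i := cw (fword X a) i.
have cl_linv l i : cl (linv l) (ix (letter l) i) = cl l i.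
  rewrite /cl /linv /= letter_linv -ixM mulVg ix1.
  by case: l => x [].
have c_letter l h i : X l.1 -> H h -> c (letter l * h) i = cl l (ix h i) (+) c h i.
  move=> Xl Hh; rewrite /c; have [_ _ eh] := fwordP HX Hh.
  have Hlh : H (letter l * h).
    by apply: subgroupM => //; apply: letter_in (basis_sub HX) Xl.
  have [->|->] := fword_cons sH HX Xl Hh; first by rewrite /= eh.
  have [_ _ elh] := fwordP HX Hlh.
  by rewrite /= elh ixM cl_linv addbA addbb.
have cM a b i : H a -> H b -> c (a * b) i = c a (ix b i) (+) c b i.
  move=> Ha Hb; move: a Ha.
  apply: (basis_ind sH HX) => [|l h Xl Hh IH].
    by rewrite mul1g /c (fword1 sH HX).
  by rewrite -mulgA !c_letter //; [rewrite IH ixM addbA|exact: subgroupM].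
pose f x := `[< exists t a,
  [/\ H a, x = a * vs t & psi t (+) c a (coset (vs t))] >].
have fE a t : H a -> f (a * vs t) = psi t (+) c a (coset (vs t)).
  move=> Ha; apply/asboolP/idP => [[u [b [Hb e]]]|h]; last by exists t, a.
  have tu : t = u.
    apply: (vs_inj _ _ (a^-1 * b)); first by apply: subgroupM => //; apply: subgroupV.
    by rewrite -mulgA -e mulKg.
  by rewrite -tu in e *; rewrite (mulIg _ _ _ e).
have f_mul b x : H b -> V x -> f (b * x) (+) f x = c b (coset x).
  move=> Hb /vsS[t [a [Ha ->]]]; rewrite mulgA !fE //; last exact: subgroupM.
  rewrite cM // ixV.
  by case: (psi t); case: (c b _); case: (c a _).
exists f; split.
- by move=> a x y Ha Vx Vy xy; rewrite !f_mul // xy.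
- move=> i; have := fE 1 i (subgroup1 sH); rewrite mul1g => ->.
  by rewrite /c (fword1 sH HX) addbF.
- move=> x i Xx; rewrite f_mul ?coset_base //; last exact: (basis_sub HX).
  have := c_letter (x, false) 1 i Xx (subgroup1 sH).
  rewrite mulg1 {1}/letter /= => ->.
  by rewrite ix1 /c (fword1 sH HX) addbF.
Qed.

Definition edge_data (f : G -> bool) : {ffun 'I_mE + 'I_n -> bool} :=
  [ffun s => match s with
             | inl i => f (es i).1 (+) f (es i).2
             | inr i => f (base i)
             end].

Definition generator_data r (xs : 'I_r -> G) (f : G -> bool) :
    {ffun 'I_r * 'I_n + 'I_mV -> bool} :=
  [ffun s => match s with
             | inl (j, i) => f (xs j * base i) (+) f (base i)
             | inr i => f (vs i)
             end].

Lemma card_edge_data : #|{: {ffun 'I_mE + 'I_n -> bool}}| = (2 ^ (mE + n))%N.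
Proof. by rewrite card_ffun card_bool card_sum !card_ord. Qed.

Lemma card_generator_data r :
  #|{: {ffun 'I_r * 'I_n + 'I_mV -> bool}}| = (2 ^ (r * n + mV))%N.
Proof. by rewrite card_ffun card_bool card_sum card_prod !card_ord. Qed.

Lemma euler_upper r (xs : 'I_r -> G) :
  (forall i, X (xs i)) -> (forall x, X x -> exists i, x = xs i) ->
  (mE + n <= r * n + mV)%N.
Proof.
move=> xsX Xxs; rewrite -(@leq_exp2l 2) // -card_edge_data -card_generator_data.
apply: (leq_card_rel (P := fun d g => exists f,
  [/\ quasi_invariant f, edge_data f = d & generator_data xs f = g])).
- move=> d; have [f [qf fe fb]] :=
    exists_of_edges (fun i => d (inl i)) (fun i => d (inr i)).
  exists (generator_data xs f), f; split=> //.
  by apply/ffunP => -[i|i]; rewrite ffunE.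
- move=> _ _ k [f [qf <- fk]] [g [qg <- gk]].
  have fgV : forall x, V x -> f x = g x.
    apply: eq_of_generators => //.
      by move=> i; have := congr1 (fun d : {ffun _ -> _} => d (inr i)) (etrans fk (esym gk));
         rewrite !ffunE.
    move=> x i /Xxs[j ->].
    have := congr1 (fun d : {ffun _ -> _} => d (inl (j, i))) (etrans fk (esym gk)).
    by rewrite !ffunE.
  apply/ffunP => -[i|i]; rewrite !ffunE ?fgV //.
    by case: esP => /(_ i)[].
  by case: esP => /(_ i)[].
Qed.

(** The family [xs] need not exhaust [X], since increments at the other generators can be set to 0;
    hence it applies before [X] is known to be finite. *)
Lemma euler_lower r (xs : 'I_r -> G) :
  injective xs -> (forall i, X (xs i)) -> (r * n + mV <= mE + n)%N.
Proof.
move=> xs_inj xsX; rewrite -(@leq_exp2l 2) // -card_edge_data -card_generator_data.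
apply: (leq_card_rel (P := fun g d => exists f,
  [/\ quasi_invariant f, edge_data f = d & generator_data xs f = g])).
- move=> d.
  have [f [qf fe fb]] := exists_of_generators
    (fun x i => if [pick j | xs j == x] is Some j then d (inl (j, i)) else false)
    (fun i => d (inr i)).
  exists (edge_data f), f; split=> //.
  apply/ffunP => -[[j i]|i]; rewrite ffunE // fb //.
  by case: pickP => [j' /eqP/xs_inj->//|/(_ j)]; rewrite eqxx.
- move=> _ _ k [f [qf fk <-]] [g [qg gk <-]].
  have fgV : forall x, V x -> f x = g x.
    apply: eq_of_edges => // i.
      have := congr1 (fun d : {ffun _ -> _} => d (inl i)) (etrans fk (esym gk)).
      by rewrite !ffunE.
    have := congr1 (fun d : {ffun _ -> _} => d (inr i)) (etrans fk (esym gk)).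
    by rewrite !ffunE.
  apply/ffunP => -[[j i]|i]; rewrite !ffunE ?fgV //; last by case: vsP.
  by apply: V_mul => //; apply: (basis_sub HX).
Qed.

End EulerCharacteristic.

(** * Subforests of the Cayley forest *)

Section CayleyForest.
Variables (G : groupType) (F W : set G).
Hypotheses (sF : subgroup F) (FW : free_basis F W).

Definition cayley (x y : G) := W (x^-1 * y).
Definition same_coset (x y : G) := F (x^-1 * y).

Lemma cayley_mul a x y : cayley (a * x) (a * y) <-> cayley x y.
Proof. by rewrite /cayley invgM mulgA mulgVK. Qed.

Lemma cayley_asym x y : cayley x y -> ~ cayley y x.
Proof.
rewrite /cayley => Wxy Wyx.
have := @basis_letter_inj _ _ _ sF FW (x^-1 * y, true) (y^-1 * x, false) Wxy Wyx.
by rewrite /letter /= invgM invgK => /(_ erefl).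
Qed.

Lemma same_coset_refl x : same_coset x x.
Proof. by rewrite /same_coset mulVg; apply: subgroup1. Qed.

Lemma same_coset_sym x y : same_coset x y -> same_coset y x.
Proof. by rewrite /same_coset => /(subgroupV sF); rewrite invgM invgK. Qed.

Lemma same_coset_trans x y z : same_coset x y -> same_coset y z -> same_coset x z.
Proof.
by rewrite /same_coset => Fxy /(subgroupM sF Fxy); rewrite mulgA mulgK.
Qed.

Lemma same_coset_mul a x y : same_coset x y -> same_coset (a * x) (a * y).
Proof. by rewrite /same_coset invgM mulgA mulgVK. Qed.

Lemma cayley_same_coset x y : cayley x y -> same_coset x y.
Proof. exact: (basis_sub FW). Qed.

Lemma adj_letter x y : adj cayley x y <-> exists2 l, W l.1 & y = x * letter l.
Proof.
split=> [[]Wxy|[[w []] Ww ->]].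
- by exists (x^-1 * y, false); rewrite // /letter /= mulVKg.
- by exists (y^-1 * x, true); rewrite // /letter /= invgM invgK mulVKg.
- by right; rewrite /cayley /letter /= invgM mulgVK invgK.
- by left; rewrite /cayley /letter /= mulKg.
Qed.

(** The labels of such a walk form a nonempty reduced word, whose value cannot be 1. *)
Lemma cayley_forest (p : nat -> G) n : (0 < n)%N ->
  (forall i, (i < n)%N -> adj cayley (p i) (p i.+1)) ->
  (forall i, (i.+1 < n)%N -> p i.+2 <> p i) -> p n <> p 0%N.
Proof.
move=> n0 pa pn pn0.
have /choice[l lP] : forall i, exists l : G * bool, (i < n)%N ->
    W l.1 /\ p i.+1 = p i * letter l.
  move=> i; have [ltin|nin] := pselect (i < n)%N; last by exists (1, true).
  by have /adj_letter[l Wl e] := pa i ltin; exists l.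
pose w := mkseq l n.
have ow : word_over W w by move=> m /mapP[i]; rewrite mem_iota => /andP[_ /lP[? _]] ->.
have rw : reduced w.
  rewrite reducedE; apply/(sortedP (1, true)) => i; rewrite size_mkseq => ltin.
  rewrite !nth_mkseq //; last exact: ltnW.
  apply/eqP => e; apply: (pn i ltin).
  have [_ ->] := lP i.+1 ltin; have [_ ->] := lP i (ltnW ltin).
  by rewrite e letter_linv mulgK.
have vw k : (k <= n)%N -> p k = p 0%N * word_value (mkseq l k).
  elim: k => [|k IH] lekn; first by rewrite word_value_nil mulg1.
  rewrite /mkseq -addn1 iotaD map_cat word_value_cat word_value_cons word_value_nil.
  rewrite mulg1 mulgA add0n addn1 -IH; last exact: ltnW.
  by have [_ ->] := lP k lekn.
have := vw n (leqnn n); rewrite pn0 -{1}[p 0%N]mulg1 => /mulgI /esym w1.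
have := fword_value sF FW ow rw; rewrite w1 (fword1 sF FW) => /(congr1 size).
by move: n0 => /[swap]; rewrite size_mkseq /= => <-.
Qed.

(** * The invariant order on edges *)

Variable lt : rel (G * bool).
Hypotheses (lt_irr : irreflexive lt) (lt_tr : transitive lt)
  (lt_tot : forall x y, x != y -> lt x y || lt y x).

(** Lexicographic: sources by the left order of [F], then labels. Only quotients such as
    [e.1^-1 * f.1] occur, which gives invariance under all of [G]; edges of different trees are
    incomparable. *)
Definition edge_lt (e f : G * G) := pos F W lt (e.1^-1 * f.1) \/
  e.1 = f.1 /\ lt (e.1^-1 * e.2, false) (f.1^-1 * f.2, false).

Lemma edge_lt_irr e : ~ edge_lt e e.
Proof.
by case=> [|[_]]; [rewrite mulVg => /(pos_irr sF FW)|rewrite lt_irr].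
Qed.

Lemma edge_lt_trans e f g : edge_lt e f -> edge_lt f g -> edge_lt e g.
Proof.
move=> [ef|[ef lef]] [fg|[fg lfg]].
- left; have := posM sF FW lt_irr lt_tr lt_tot ef fg.
  by rewrite mulgA mulgK.
- by left; rewrite -fg.
- by left; rewrite ef.
- by right; split; [rewrite ef|apply: lt_tr lfg].
Qed.

Lemma edge_lt_total e f : cayley e.1 e.2 -> cayley f.1 f.2 ->
  same_coset e.1 f.1 -> [\/ e = f, edge_lt e f | edge_lt f e].
Proof.
case: e f => [x y] [z t] /= _ _ xz.
have [e|ne] := eqVneq (x^-1 * z) 1; last first.
  have [ef|fe] := pos_total sF FW lt_irr lt_tr lt_tot xz ne.
    by constructor 2; left.
  by constructor 3; left; move: fe; rewrite invgM invgK.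
have {e xz} exz : x = z by rewrite -[x]mulg1 -e mulVKg.
rewrite -exz; have [->|nyt] := eqVneq y t; first by constructor 1.
have : (x^-1 * y, false) != (x^-1 * t, false).
  by rewrite xpair_eqE eqxx andbT (inj_eq (mulgI _)).
by move=> /lt_tot/orP[yt|ty]; [constructor 2|constructor 3]; right.
Qed.

Lemma edge_lt_mul a e f : edge_lt e f -> edge_lt (eact a e) (eact a f).
Proof.
rewrite /edge_lt /eact /= !invgM !mulgA !mulgVK.
by move=> [|[-> ?]]; [left|right].
Qed.

(** Phrased with the geodesic from [x] to [y], which does not depend on [V], so that it passes to
    intersections. *)
Definition convex (V : set G) := forall x y, V x -> V y -> same_coset x y ->
  forall k, V (x * word_value (take k (fword W (x^-1 * y)))).

Lemma convexI V V' : convex V -> convex V' -> convex (V `&` V').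
Proof. by move=> cV cV' x y [? ?] [? ?] xy k; split; [apply: cV|apply: cV']. Qed.

Lemma convex_reach V x y : convex V -> V x -> V y -> same_coset x y ->
  reach (fun x y => [/\ V x, V y & adj cayley x y]) x y.
Proof.
move=> cV Vx Vy xy; have := cV x y Vx Vy xy.
have [ow _ ew] := fwordP FW xy.
set w := fword W _ in ow ew * => Vw.
have step k : (k <= size w)%N -> reach (fun x y => [/\ V x, V y & adj cayley x y])
    x (x * word_value (take k w)).
  elim: k => [|k IH] ltk; first by rewrite take0 word_value_nil mulg1; apply: reach_refl.
  apply: reach_step (IH (ltnW ltk)) _; split=> //.
  apply/adj_letter; exists (nth (1, true) w k); first by apply: ow; rewrite mem_nth.
  rewrite (take_nth (1, true) ltk) -cats1 word_value_cat word_value_cons.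
  by rewrite word_value_nil mulg1 mulgA.
by have := step _ (leqnn _); rewrite take_size ew mulVKg.
Qed.

Definition finite_quotient (H V : set G) := exists2 U, finite_set U &
  forall x, V x -> exists a u, [/\ H a, U u & x = a * u].

(** The basis [W] may be infinite. Finitely many labels make [V] locally finite and, with a finite
    quotient, leave finitely many orbits of edges. *)
Definition finite_labels (V : set G) := exists2 W1, finite_set W1 &
  forall x y, V x -> V y -> cayley x y -> W1 (x^-1 * y).

(* Convexity and the base points make V meet every coset of F in a nonempty
   subtree. *)
Record subforest n (base : 'I_n -> G) (H V : set G) : Prop := Subforest {
  subforest_mul : forall a x, H a -> V x -> V (a * x);
  subforest_base : forall i, V (base i);
  subforest_convex : convex V;
  subforest_finite : finite_quotient H V;
  subforest_labels : finite_labels V }.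

Section Counting.
Variables (n : nat) (coset : G -> 'I_n) (base : 'I_n -> G).
Hypothesis cosetP : forall x y, coset x = coset y <-> F (x^-1 * y).
Hypothesis coset_base : forall i, coset (base i) = i.

Definition bridges V : set (G * G) :=
  [set e | edges W V e /\ bridge cayley edge_lt V e.1 e.2].

Section OneSubgroup.
Variables (H X V : set G).
Hypotheses (sH : subgroup H) (HX : free_basis H X) (X0 : X !=set0).
Hypothesis VH : subforest base H V.

Lemma subforest_reach x y : V x -> V y -> same_coset x y ->
  reach (fun x y => [/\ V x, V y & adj cayley x y]) x y.
Proof. by apply: convex_reach; case: VH. Qed.

Lemma edges_mul a e : H a -> edges W V e -> edges W V (eact a e).
Proof.
move=> Ha [V1 V2 We]; split; [exact: (subforest_mul VH)|exact: (subforest_mul VH)|].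
exact/cayley_mul.
Qed.

Lemma edge_transversal (S : set (G * G)) : S `<=` edges W V ->
  (forall a e, H a -> S e -> S (eact a e)) ->
  exists m (r : 'I_m -> G * G), orbit_transversal H (@eact G) S r.
Proof.
move=> SE Smul; have [U finU VU] := subforest_finite VH.
have [W1 finW1 VW1] := subforest_labels VH.
apply: (transversal_exists sH (@eact1 G) (@eact_mul G) (U := (fun uw => (uw.1, uw.1 * uw.2)) @` (U `*` W1))) => //.
  exact/finite_image/finite_setX.
move=> [x y] /SE[/= Vx Vy xy]; have [a [u [Ha Uu ex]]] := VU x Vx.
exists (u, u * (x^-1 * y)); first by exists (u, x^-1 * y) => //=; split=> //=; apply: VW1.
by exists a => //; rewrite /eact /= !mulgA -ex mulgV mul1g.
Qed.

Lemma vertex_transversal : exists m (r : 'I_m -> G), orbit_transversal H mul V r.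
Proof.
have [U finU VU] := subforest_finite VH.
apply: (transversal_exists sH (@mul1g G) (fun a b t => esym (mulgA a b t)) (U := U)) => //.
  by move=> a t Ha Vt; apply: (subforest_mul VH).
by move=> t /VU[a [u [Ha Uu ->]]]; exists u => //; exists a.
Qed.

Lemma bridges_mul a e : H a -> bridges V e -> bridges V (eact a e).
Proof.
move=> Ha [Ee be]; split; first exact: edges_mul.
exact: (bridge_mul cayley_mul edge_lt_mul (subforest_mul VH)).
Qed.

Lemma bridge_transversal : exists m (r : 'I_m -> G * G),
  orbit_transversal H (@eact G) (bridges V) r.
Proof. by apply: edge_transversal => [e []|]; last exact: bridges_mul. Qed.

Lemma subforest_locally_finite x : V x ->
  finite_set [set y | V y /\ adj cayley x y].
Proof.
move=> Vx; have [W1 finW1 VW1] := subforest_labels VH.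
apply: (@sub_finite_set _ _ ((fun w => x * w) @` W1 `|` (fun w => x * w^-1) @` W1)).
  move=> y [Vy [xy|yx]].
    by left; exists (x^-1 * y); [exact: VW1|rewrite mulVKg].
  by right; exists (y^-1 * x); [exact: VW1|rewrite invgM invgK mulVKg].
by rewrite finite_setU; split; apply: finite_image.
Qed.

(** Among the translates of [x] by [n + 1] powers of a basis element two lie in the same coset. This
    is where the finite index produces translations of a tree. *)
Lemma subforest_periodic x : V x -> exists y a,
  [/\ V y, same_coset x y, H a, a != 1 & same_coset y (a * y)].
Proof.
move=> Vx; have [x0 Xx0] := X0; exists x.
suff [d d0 xd] : exists2 d, (0 < d)%N & same_coset x (x0 ^+ d * x).
  exists (x0 ^+ d); split=> //; first exact: same_coset_refl.
    elim: d {d0 xd} => [|d IH]; first exact: subgroup1.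
    by rewrite expgS; apply: subgroupM => //; apply: (basis_sub HX).
  exact: (basis_expgn_neq1 sH HX).
have noinj : ~ injective (fun k : 'I_n.+1 => coset (x0 ^+ k * x)).
  by move=> /leq_card; rewrite !card_ord ltnn.
have [j [k [ltjk e]]] : exists j k : nat, (j < k)%N /\
    coset (x0 ^+ j * x) = coset (x0 ^+ k * x).
  apply: contrapT => noj; apply: noinj => j k e; apply: val_inj.
  by case: (ltngtP j k) => // jk; case: noj; [exists j, k|exists k, j].
exists (k - j)%N; first by rewrite subn_gt0.
have /cosetP/(same_coset_mul (x0 ^+ j)^-1) := e.
by rewrite mulKg mulgA -{1}(subnKC (ltnW ltjk)) expgnDr mulKg.
Qed.

Local Notation oedge := (oriented cayley).

Lemma cayley_adj_edge x y : V x -> V y -> adj cayley x y -> edges W V (oedge x y).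
Proof.
move=> Vx Vy xy; have := oriented_ori xy.
by rewrite /oriented; case: asboolP => _ ?; split.
Qed.

Lemma bridge_sym x y : bridge cayley edge_lt V x y -> bridge cayley edge_lt V y x.
Proof. by case. Qed.

Lemma bridge_oedge x y :
  bridge cayley edge_lt V (oedge x y).1 (oedge x y).2 <-> bridge cayley edge_lt V x y.
Proof. by rewrite /oriented; case: asboolP => _ //=; split; apply: bridge_sym. Qed.

(** By [nonbridge_matching], sending a bridge to itself and a vertex [x] to the edge joining it to
    [nxt x] is a bijection on orbits. *)
Lemma card_edges mV mE mB (vs : 'I_mV -> G) (es bs : _ -> G * G) :
  orbit_transversal H mul V vs -> orbit_transversal H (@eact G) (edges W V) (m := mE) es ->
  orbit_transversal H (@eact G) (bridges V) (m := mB) bs -> mE = (mB + mV)%N.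
Proof.
move=> [vsV vsS vs_inj] [esE esS es_inj] [bsB bsS bs_inj].
have [nxt [nxt_nb nxt_nxt nb_nxt nxt_mul]] := nonbridge_matching sH cayley_mul
  cayley_asym same_coset_refl same_coset_sym same_coset_trans same_coset_mul
  cayley_same_coset cayley_forest edge_lt_irr edge_lt_trans edge_lt_total
  edge_lt_mul (subforest_mul VH) (subforest_finite VH) subforest_locally_finite
  subforest_reach subforest_periodic.
pose t (s : 'I_mB + 'I_mV) :=
  match s with inl k => bs k | inr v => oedge (vs v) (nxt (vs v)) end.
have mulC a b e : eact a e = eact b (eact (b^-1 * a) e).
  by rewrite -eact_mul mulgA mulgV mul1g.
have solve a b e f : H a -> H b -> eact a e = eact b f -> exists2 c, H c & e = eact c f.
  move=> Ha Hb e1; exists (a^-1 * b); first by apply: subgroupM => //; apply: subgroupV.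
  by rewrite eact_mul -e1 -eact_mul mulVg eact1.
have tE s : edges W V (t s).
  case: s => [k|v] /=; first by case: (bsB k).
  by have [? ? ? _] := nxt_nb _ (vsV v); apply: cayley_adj_edge.
have t_bridge s : bridge cayley edge_lt V (t s).1 (t s).2 <-> if s is inl _ then True else False.
  case: s => [k|v] /=; first by case: (bsB k).
  have [_ _ _ nb] := nxt_nb _ (vsV v).
  by split=> // /bridge_oedge.
have t_inj s s' a : H a -> t s = eact a (t s') -> s = s'.
  move=> Ha e; have b : (if s is inl _ then True else False) <-> if s' is inl _ then True else False.
    rewrite -!t_bridge; split=> [|bs'].
      have e' : t s' = eact a^-1 (t s) by rewrite e -eact_mul mulVg eact1.
      rewrite e'; apply: (bridge_mul cayley_mul edge_lt_mul (subforest_mul VH)).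
      exact: subgroupV.
    rewrite e; exact: (bridge_mul cayley_mul edge_lt_mul (subforest_mul VH)).
  case: s s' b e => [k|v] [k'|v'] [b b'] e.
  - by rewrite (bs_inj _ _ _ Ha e).
  - by case: b.
  - by case: b'.
  move: e; rewrite /= -(oriented_mul cayley_mul) -nxt_mul // => /oriented_endpoints[[e _]|[e1 e2]].
    by rewrite (vs_inj _ _ _ Ha e).
  (* The edges coincide with their ends exchanged, so each end would be the [nxt] of the other. *)
  case: (nxt_nxt (a * vs v')); first exact: (subforest_mul VH).
  by rewrite -e1.
apply/eqP; rewrite eqn_leq; apply/andP; split.
  rewrite -[mE]card_ord -[mB]card_ord -[mV]card_ord -card_sum.
  apply: (leq_card_rel (P := fun i s => exists2 a, H a & es i = eact a (t s))).
    move=> i; have [b|nb] := pselect (bridge cayley edge_lt V (es i).1 (es i).2).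
      by have [k [a [Ha e]]] := bsS _ (conj (esE i) b); exists (inl k), a.
    case: (es i) (esE i) nb => x y [/= Vx Vy xy] nb.
    have axy : adj cayley x y by left.
    have : nonbridge cayley edge_lt V x y by split.
    have exy : (x, y) = oedge x y by rewrite orientedE.
    move=> /nb_nxt[ny|ny].
      have [v [a [Ha ev]]] := vsS x Vx; exists (inr v), a => //=.
      by rewrite -(oriented_mul cayley_mul) -nxt_mul // -ev ny.
    have [v [a [Ha ev]]] := vsS y Vy; exists (inr v), a => //=.
    rewrite -(oriented_mul cayley_mul) -nxt_mul // -ev ny exy.
    exact: orientedC cayley_asym _ _ axy.
  move=> i j s [a Ha ei] [b Hb ej].
  apply: (es_inj i j (a * b^-1)); first by apply: subgroupM => //; apply: subgroupV.
  by rewrite ei ej -eact_mul mulgVK.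
rewrite -[mE]card_ord -[mB]card_ord -[mV]card_ord -card_sum.
apply: (leq_card_rel (P := fun s i => exists2 a, H a & t s = eact a (es i))).
  by move=> s; have [i [a [Ha e]]] := esS _ (tE s); exists i, a.
move=> s s' i [a Ha e] [b Hb e'].
apply: (t_inj s s' (a * b^-1)); first by apply: subgroupM => //; apply: subgroupV.
by rewrite e e' -eact_mul mulgVK.
Qed.

Lemma subforest_coset_reach x y : V x -> V y -> coset x = coset y ->
  reach (fun x y => [/\ V x, V y & W (x^-1 * y) \/ W (y^-1 * x)]) x y.
Proof. by move=> Vx Vy /cosetP xy; apply: subforest_reach. Qed.

Lemma bridges_upper mB (bs : 'I_mB -> G * G) r (xs : 'I_r -> G) :
  orbit_transversal H (@eact G) (bridges V) bs ->
  (forall i, X (xs i)) -> (forall x, X x -> exists i, x = xs i) ->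
  (mB + n <= r * n)%N.
Proof.
move=> bsP xsX Xxs; have [mV [vs vsP]] := vertex_transversal.
have [mE [es esP]] : exists m (r : 'I_m -> G * G),
  orbit_transversal H (@eact G) (edges W V) r by apply: edge_transversal => //; apply: edges_mul.
have := euler_upper sH HX sF FW cosetP coset_base (subforest_base VH)
  (subforest_mul VH) subforest_coset_reach vsP esP xsX Xxs.
by rewrite (card_edges vsP esP bsP); lia.
Qed.

Lemma bridges_lower mB (bs : 'I_mB -> G * G) r (xs : 'I_r -> G) :
  orbit_transversal H (@eact G) (bridges V) bs ->
  injective xs -> (forall i, X (xs i)) -> (r * n <= mB + n)%N.
Proof.
move=> bsP xs_inj xsX; have [mV [vs vsP]] := vertex_transversal.
have [mE [es esP]] : exists m (r : 'I_m -> G * G),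
  orbit_transversal H (@eact G) (edges W V) r by apply: edge_transversal => //; apply: edges_mul.
have := euler_lower sH HX FW cosetP coset_base (subforest_base VH)
  (subforest_mul VH) subforest_coset_reach vsP esP xs_inj xsX.
by rewrite (card_edges vsP esP bsP); lia.
Qed.

End OneSubgroup.
(** Witnessing rays in [V] are still rays in [V'], and the comparison of edges does not involve the
    subforest. *)
Lemma bridges_sub V V' : V `<=` V' -> bridges V `<=` bridges V'.
Proof.
move=> sub e [[V1 V2 We] b]; split; first by split=> //; apply: sub.
have half_sub x y : half_bridge cayley edge_lt V x y -> half_bridge cayley edge_lt V' x y.
  by move=> [p [[pV pa pn] p0 p1 pl]]; exists p; split=> //; split=> // i; apply: sub.
by case: b => ? ?; split; apply: half_sub.
Qed.

(** For the finite quotient: points with the same pair of representatives differ by a unique element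
    of [G], which then lies in both [H] and [K]. So one point per pair suffices. *)
Lemma subforestI H K V V' : subgroup H -> subgroup K ->
  subforest base H V -> subforest base K V' -> subforest base (H `&` K) (V `&` V').
Proof.
move=> sH sK VH VK; split.
- move=> a x [Ha Ka] [Vx V'x].
  by split; [exact: (subforest_mul VH)|exact: (subforest_mul VK)].
- by move=> i; split; [exact: (subforest_base VH)|exact: (subforest_base VK)].
- by apply: convexI; [exact: (subforest_convex VH)|exact: (subforest_convex VK)].
- have [U finU VU] := subforest_finite VH; have [U' finU' VU'] := subforest_finite VK.
  pose f (u : G * G) := xget 1 [set x | (exists2 a, H a & x = a * u.1) /\
                                        (exists2 a, K a & x = a * u.2)].
  exists (f @` (U `*` U')); first exact/finite_image/finite_setX.
  move=> x [/VU[a [u [Ha Uu ex]]] /VU'[b [u' [Kb Uu' ex']]]].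
  have [[c Hc ec] [d Kd ed]] : (exists2 a, H a & f (u, u') = a * u) /\
      (exists2 a, K a & f (u, u') = a * u').
    apply: (@xgetI _ 1 [set x | (exists2 a, H a & x = a * u) /\
                                (exists2 a, K a & x = a * u')] x).
    by split; [exists a|exists b].
  exists (x * (f (u, u'))^-1), (f (u, u')); split; last by rewrite mulgVK.
    split; [rewrite ex ec|rewrite ex' ed]; rewrite invgM mulgA mulgK;
      by apply: subgroupM => //; apply: subgroupV.
  by exists (u, u').
- have [W1 finW1 VW1] := subforest_labels VH; exists W1 => // x y [Vx _] [Vy _].
  exact: VW1.
Qed.

(** Left multiplication is free, so the element of [H] and the element of [K] carrying one bridge to
    another coincide. *)
Lemma bridges_inter H K V V' m mH mK (r : 'I_m -> G * G)
    (rH : 'I_mH -> G * G) (rK : 'I_mK -> G * G) :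
  subgroup H -> subgroup K ->
  orbit_transversal (H `&` K) (@eact G) (bridges (V `&` V')) r ->
  orbit_transversal H (@eact G) (bridges V) rH ->
  orbit_transversal K (@eact G) (bridges V') rK -> (m <= mH * mK)%N.
Proof.
move=> sH sK [rB _ r_inj] [_ rHS _] [_ rKS _].
rewrite -[m]card_ord -[mH]card_ord -[mK]card_ord -card_prod.
apply: (leq_card_rel (P := fun i (jk : 'I_mH * 'I_mK) =>
  (exists2 a, H a & r i = eact a (rH jk.1)) /\
  (exists2 a, K a & r i = eact a (rK jk.2)))).
  move=> i; have [j [a [Ha e]]] := rHS _ (bridges_sub (@subIsetl _ _ _) (rB i)).
  have [k [b [Kb e']]] := rKS _ (bridges_sub (@subIsetr _ _ _) (rB i)).
  by exists (j, k); split; [exists a|exists b].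
move=> i i' [j k] [[a Ha ea] [b Kb eb]] [[a' Ha' ea'] [b' Kb' eb']].
have E (c d : G) e : eact c e = eact (c * d^-1) (eact d e) by rewrite -eact_mul mulgVK.
apply: (r_inj i i' (a * a'^-1)); last by rewrite ea (E a a') -ea'.
split; first by apply: subgroupM => //; apply: subgroupV.
have -> : a * a'^-1 = b * b'^-1.
  have : eact (a * a'^-1) (r i') = eact (b * b'^-1) (r i').
    by rewrite {1}ea' -E -ea eb eb' -E.
  by case=> /mulIg.
by apply: subgroupM => //; apply: subgroupV.
Qed.

(* The H-orbit of the base points together with the paths joining x * base i to
   the base point of its coset, for x in the basis X. *)
Lemma subforest_exists H X : subgroup H -> free_basis H X -> finite_set X ->
  exists V, subforest base H V.
Proof.
move=> sH HX finX.
pose end_ x i := base (coset (x * base i)).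
pose word x i := fword W ((x * base i)^-1 * end_ x i).
have wordP x i : F ((x * base i)^-1 * end_ x i) by apply/cosetP; rewrite coset_base.
pose pt x i k := x * base i * word_value (take k (word x i)).
pose U := range base `|` \bigcup_(x in X) \bigcup_(i in [set: 'I_n])
  [set` mkseq (pt x i) (size (word x i)).+1].
pose W1 := \bigcup_(x in X) \bigcup_(i in [set: 'I_n]) [set` map fst (word x i)].
pose V := [set v | exists a u, [/\ H a, U u & v = a * u]].
have finU : finite_set U.
  rewrite finite_setU; split; first exact/finite_image/finite_finset.
  by apply: bigcup_finite => // x _; apply: bigcup_finite => // i _.
have finW1 : finite_set W1.
  by apply: bigcup_finite => // x _; apply: bigcup_finite => // i _.
have Vmul a x : H a -> V x -> V (a * x).
  move=> Ha [b [u [Hb Uu ->]]]; exists (a * b), u; split=> //; last by rewrite mulgA.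
  exact: subgroupM.
have VU u : U u -> V u.
  by move=> Uu; exists 1, u; split=> //; [exact: subgroup1|rewrite mul1g].
pose S x y := [/\ V x, V y & exists l, [/\ W l.1, W1 l.1 & y = x * letter l]].
have Ssym x y : S x y -> S y x.
  move=> [Vx Vy [l [Wl W1l e]]]; split=> //; exists (linv l); split=> //.
  by rewrite letter_linv e mulgK.
have Smul a x y : H a -> reach S x y -> reach S (a * x) (a * y).
  move=> Ha; elim=> [|u v _ IH [Vu Vv [l [Wl W1l e]]]]; first exact: reach_refl.
  apply: reach_step IH _; split; [exact: Vmul|exact: Vmul|exists l].
  by split=> //; rewrite e mulgA.
have cosetF x f : F f -> coset (x * f) = coset x.
  by move=> Ff; apply/cosetP; rewrite invgM mulgVK; apply: subgroupV.
have pt_reach x i k : X x -> (k <= size (word x i))%N -> reach S (pt x i k) (end_ x i).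
  move=> Xx; have [ow _ ew] := fwordP FW (wordP x i); rewrite -/(word x i) in ow ew.
  have Upt j : (j <= size (word x i))%N -> V (pt x i j).
    move=> lej; apply: VU; right; exists x => //; exists i => //=.
    by apply: map_f; rewrite mem_iota add0n ltnS.
  have ends : pt x i (size (word x i)) = end_ x i by rewrite /pt take_size ew mulVKg.
  move=> lek; rewrite -ends; move: (subnKC lek).
  move: (size _ - k)%N => d; elim: d k {lek} => [|d IH] j ejd.
    by rewrite -ejd addn0; apply: reach_refl.
  have ltj : (j < size (word x i))%N by rewrite -ejd; lia.
  have lej := ltnW ltj; apply: reach_trans (reach1 _) (IH j.+1 _); last by lia.
  split; [exact: Upt|exact: Upt|exists (nth (1, true) (word x i) j)].
  have mj : nth (1, true) (word x i) j \in word x i by rewrite mem_nth.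
  split; [exact: ow| |].
    by exists x => //; exists i => //=; apply: map_f.
  rewrite /pt (take_nth (1, true) ltj) -cats1 word_value_cat word_value_cons.
  by rewrite word_value_nil mulg1 mulgA.
have letter_reach l j : X l.1 ->
    reach S (letter l * base j) (base (coset (letter l * base j))).
  case: l => x [] Xx; rewrite /letter /=; last first.
    have := pt_reach x j 0%N Xx (leq0n _).
    by rewrite /pt take0 word_value_nil mulg1.
  (* For an inverse letter, the path attached to [x] and [i] is reversed and translated by
     [x^-1]. *)
  set i := coset _.
  have ei : coset (x * base i) = j.
    have -> : j = coset (x * (x^-1 * base j)) by rewrite mulVKg coset_base.
    have /cosetP Fi : coset (base i) = coset (x^-1 * base j) by rewrite coset_base.
    by apply/cosetP; exact: same_coset_mul Fi.
  have := pt_reach x i 0%N Xx (leq0n _).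
  rewrite /pt take0 word_value_nil mulg1 /end_ ei => r.
  have Hx : H x^-1 by apply: subgroupV (basis_sub HX Xx).
  by have := Smul _ _ _ Hx (reach_sym Ssym r); rewrite mulKg.
have base_reach a : H a -> forall i, reach S (a * base i) (base (coset (a * base i))).
  move: a; apply: (basis_ind sH HX) => [i|l h Xl Hh IH i].
    by rewrite mul1g coset_base; apply: reach_refl.
  have Hl : H (letter l) := letter_in sH (basis_sub HX) Xl.
  have r := Smul _ _ _ Hl (IH i); rewrite mulgA in r; apply: reach_trans r _.
  have <- : coset (letter l * base (coset (h * base i))) = coset (letter l * h * base i).
    have /cosetP Fi : coset (base (coset (h * base i))) = coset (h * base i).
      by rewrite coset_base.
    by apply/cosetP; rewrite -[letter l * h * _]mulgA; exact: same_coset_mul Fi.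
  exact: letter_reach.
have V_reach v : V v -> reach S v (base (coset v)).
  have orbit_reach a u j : H a -> reach S u (base j) -> coset u = j ->
      reach S (a * u) (base (coset (a * u))).
    move=> Ha r e; apply: reach_trans (Smul _ _ _ Ha r) _.
    have <- : coset (a * base j) = coset (a * u).
      have /cosetP Fi : coset (base j) = coset u by rewrite coset_base.
      by apply/cosetP; exact: same_coset_mul Fi.
    exact: base_reach.
  move=> [a [u [Ha Uu ->]]]; case: Uu => [[i _ <-]|[x Xx [i _ /= /mapP[k kin ->]]]].
    exact: base_reach.
  have lek : (k <= size (word x i))%N by move: kin; rewrite mem_iota add0n ltnS.
  apply: (orbit_reach _ _ _ Ha (pt_reach _ _ _ Xx lek)).
  have Fw : F (word_value (take k (word x i))).
    apply: (word_value_in sF (basis_sub FW)) => l /mem_take.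
    by have [ow _ _] := fwordP FW (wordP x i); apply: ow.
  by rewrite /pt cosetF.
(* Along an [S]-walk, each step either puts its edge in front of the geodesic to [y] or removes the
   first edge of it; vertices stay in [V] and labels in [W1]. *)
have S_convex x y : reach S y x -> V y -> V x /\
    (forall k, V (x * word_value (take k (fword W (x^-1 * y))))) /\
    F (x^-1 * y) /\ word_over W1 (fword W (x^-1 * y)).
  elim=> [|z t _ IH [Vz Vt [l [Wl W1l e]]]] Vy.
    split=> //; rewrite mulVg (fword1 sF FW).
    split; first by move=> k; rewrite word_value_nil mulg1.
    by split; [exact: subgroup1|exact: word_over_nil].
  have [_ [Vk [Fz W1z]]] := IH Vy; split=> //.
  have ez : t^-1 * y = letter (linv l) * (z^-1 * y).
    by rewrite e letter_linv invgM mulgA.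
  have ezt : z = t * letter (linv l) by rewrite e letter_linv mulgK.
  have Fl : F (letter (linv l)) by apply: letter_in sF (basis_sub FW) _.
  rewrite ez; have Wl' : W (linv l).1 by [].
  have [->|ew] := fword_cons sF FW Wl' Fz.
    split; first by case=> [|k]; rewrite ?take0 ?word_value_nil ?mulg1 //=
      word_value_cons mulgA -ezt.
    by split; [exact: subgroupM|apply/word_over_cons].
  split; last first.
    by split; [exact: subgroupM|move: W1z; rewrite ew => /word_over_cons[]].
  by move=> k; have := Vk k.+1; rewrite ew /= word_value_cons linvK -/(letter l) mulgA -e.
have V_convex x y : V x -> V y -> same_coset x y ->
    (forall k, V (x * word_value (take k (fword W (x^-1 * y))))) /\
    word_over W1 (fword W (x^-1 * y)).
  move=> Vx Vy /cosetP xy; have r : reach S y x.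
    by apply: reach_trans (V_reach y Vy) _; rewrite -xy; apply: reach_sym (V_reach x Vx).
  by have [_ [? [_ ?]]] := S_convex x y r Vy.
exists V; split=> //.
- by move=> i; apply: VU; left; exists i.
- by move=> x y Vx Vy xy; have [] := V_convex x y Vx Vy xy.
- by exists U.
- exists W1 => // x y Vx Vy Wxy.
  have [_ ow] := V_convex x y Vx Vy (cayley_same_coset Wxy).
  have ow1 : word_over W [:: (x^-1 * y, false)] by apply: word_over1.
  have := fword_value sF FW ow1 isT.
  rewrite word_value_cons word_value_nil mulg1 {1}/letter /= => e.
  by move: ow; rewrite e => /word_over_cons[].
Qed.

(** This is [n (r - 1) <= n (p - 1) * n (q - 1)] with the negative terms moved across, to avoid
    truncated subtraction. *)
Lemma intersection_rank_bound A B X Y Z p q r (xs : 'I_p -> G) (ys : 'I_q -> G)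
    (zs : 'I_r -> G) :
  subgroup A -> subgroup B -> free_basis A X -> free_basis B Y ->
  free_basis (A `&` B) Z -> X !=set0 -> Y !=set0 -> Z !=set0 ->
  (forall i, X (xs i)) -> (forall x, X x -> exists i, x = xs i) ->
  (forall i, Y (ys i)) -> (forall y, Y y -> exists i, y = ys i) ->
  injective zs -> (forall i, Z (zs i)) ->
  (r * n + p * n * n + q * n * n <= (p * n) * (q * n) + n + n * n)%N.
Proof.
move=> sA sB AX BY CZ X0 Y0 Z0 xsX Xxs ysY Yys zs_inj zsZ.
have finX : finite_set X.
  by apply: sub_finite_set (finite_image xs (@finite_finset _ setT)) => x /Xxs[i ->]; exists i.
have finY : finite_set Y.
  by apply: sub_finite_set (finite_image ys (@finite_finset _ setT)) => x /Yys[i ->]; exists i.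
have sC := subgroupI sA sB.
have [V VA] := subforest_exists sA AX finX; have [V' VB] := subforest_exists sB BY finY.
have VC := subforestI sA sB VA VB.
have [mA [rA rAP]] := bridge_transversal sA VA.
have [mB [rB rBP]] := bridge_transversal sB VB.
have [mC [rC rCP]] := bridge_transversal sC VC.
have hA := bridges_upper sA AX X0 VA rAP xsX Xxs.
have hB := bridges_upper sB BY Y0 VB rBP ysY Yys.
have hC := bridges_lower sC CZ Z0 VC rCP zs_inj zsZ.
have := bridges_inter sA sB rCP rAP rBP.
nia.
Qed.

End Counting.
End CayleyForest.

(** * Cardinal arithmetic *)

Section Cardinals.
Local Open Scope card_scope.

Lemma inj_card_le_sub T U (f : T -> U) (A : set T) (B : set U) :
  (forall x, A x -> B (f x)) -> {in A &, injective f} -> A #<= B.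
Proof.
move=> fAB /inj_card_eq; rewrite card_eq_le => /andP[_ le]; apply: card_le_trans le _.
by apply: subset_card_le => _ [x Ax <-]; apply: fAB.
Qed.

Lemma card_le_inj T U (u0 : U) (A : set T) (B : set U) : A #<= B ->
  exists f, (forall x, A x -> B (f x)) /\ {in A &, injective f}.
Proof.
elim/Ppointed: U => U in u0 B *; first by case: (no u0).
by move=> /pcard_leP/injfunPex[f fAB finj]; exists f.
Qed.

(** A maximal partial injection between [A] and [B] has full domain or full range, since otherwise a
    pair could be added. *)
Lemma card_le_total T U (A : set T) (B : set U) : A #<= B \/ B #<= A.
Proof.
pose P (R : set (T * U)) := [/\ forall x y, R (x, y) -> A x /\ B y,
  forall x y z, R (x, y) -> R (x, z) -> y = z &
  forall x y z, R (x, z) -> R (y, z) -> x = y].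
have [|R [[RAB Rf Ri] Rmax]] := @Zorn_bigcup _ P.
  move=> F FP Ftot; have dir u v : (\bigcup_(X in F) X) u -> (\bigcup_(X in F) X) v ->
      exists X, [/\ P X, X u & X v].
    move=> [X FX Xu] [Y FY Yv]; have [XY|YX] := Ftot X Y FX FY.
      by exists Y; split=> //; [exact: FP|exact: XY].
    by exists X; split=> //; [exact: FP|exact: YX].
  split.
  - by move=> x y [X /FP[h _ _] /h].
  - by move=> x y z h1 h2; have [X [[_ h _] u v]] := dir _ _ h1 h2; apply: h u v.
  - by move=> x y z h1 h2; have [X [[_ _ h] u v]] := dir _ _ h1 h2; apply: h u v.
have [dom|/existsNP[x /not_implyP[Ax ndom]]] :=
    pselect (forall x, A x -> exists y, R (x, y)).
  left; have [->|/set0P[x0 Ax0]] := eqVneq A set0; first exact: card_ge0.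
  have [y0 _] := dom x0 Ax0.
  have /choice[f fR] : forall x, exists y, A x -> R (x, y).
    by move=> x; have [/dom[y xy]|nAx] := pselect (A x); [exists y|exists y0].
  apply: (@inj_card_le_sub _ _ f) => [x /fR/RAB[]//|x y /set_mem Ax /set_mem Ay e].
  by apply: (Ri x y (f x)); [exact: fR|rewrite e; exact: fR].
have [ran|/existsNP[y /not_implyP[By nran]]] :=
    pselect (forall y, B y -> exists x, R (x, y)).
  right; have /choice[f fR] : forall y, exists x', B y -> R (x', y).
    by move=> y; have [/ran[x' xy]|nAx] := pselect (B y); [exists x'|exists x].
  apply: (@inj_card_le_sub _ _ f) => [y /fR/RAB[]//|y z /set_mem By /set_mem Bz e].
  by apply: (Rf (f y) y z); [exact: fR|rewrite e; exact: fR].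
case: (Rmax (R `|` [set (x, y)])).
  split=> [e|/(_ (x, y)) h]; first by left.
  by apply: ndom; exists y; apply: h; right.
split.
- by move=> x' y' [/RAB//|[-> ->]].
- move=> x' y' z' [h|[ex ey]] [h'|[ex' ez]].
  + exact: Rf h h'.
  + by case: ndom; exists y'; rewrite -ex'.
  + by case: ndom; exists z'; rewrite -ex.
  + by rewrite ey ez.
- move=> x' y' z' [h|[ex ez]] [h'|[ey ez']].
  + exact: Ri h h'.
  + by case: nran; exists x'; rewrite -ez'.
  + by case: nran; exists y'; rewrite -ez.
  + by rewrite ex ey.
Qed.

(** * The square of an infinite cardinal *)

Section Square.
Variables (T : Type) (D : set T).

(* R is the graph of an injection E * E -> E, where E is read off the diagonal. *)
Let diag (R : set (T * T * T)) : set T := [set x | exists z, R (x, x, z)].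

Let square (R : set (T * T * T)) := [/\
  forall x y z, R (x, y, z) -> [/\ diag R x, diag R y & diag R z],
  forall x y, diag R x -> diag R y -> exists z, R (x, y, z),
  forall x y z z', R (x, y, z) -> R (x, y, z') -> z = z',
  forall x y x' y' z, R (x, y, z) -> R (x', y', z) -> (x, y) = (x', y') &
  diag R `<=` D].

Lemma square_fun R : square R -> exists f : T -> T -> T,
  [/\ forall x y, diag R x -> diag R y -> R (x, y, f x y),
      forall x y, diag R x -> diag R y -> diag R (f x y) &
      forall x y x' y', diag R x -> diag R y -> diag R x' -> diag R y' ->
        f x y = f x' y' -> (x, y) = (x', y')].
Proof.
move=> [Rd Re Rf Ri RD].
have /choice[f fR] : forall u : T * T, exists z, diag R u.1 -> diag R u.2 ->
    R (u.1, u.2, z).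
  move=> u; have [[h1 h2]|n] := pselect (diag R u.1 /\ diag R u.2).
    by have [z uz] := Re _ _ h1 h2; exists z.
  by exists u.1 => h1 h2; case: n.
exists (fun x y => f (x, y)); split=> [x y Ex Ey|x y Ex Ey|x y x' y' Ex Ey Ex' Ey' e].
- exact: (fR (x, y)).
- by have [] := Rd _ _ _ (fR (x, y) Ex Ey).
- by apply: (Ri _ _ _ _ (f (x, y))); [exact: (fR (x, y))|rewrite e; exact: (fR (x', y'))].
Qed.

Lemma square_extend R (f : T -> T -> T) (h : T -> T) e0 e1 : square R ->
  (forall x y, diag R x -> diag R y -> R (x, y, f x y)) ->
  (forall x y, diag R x -> diag R y -> diag R (f x y)) ->
  (forall x y x' y', diag R x -> diag R y -> diag R x' -> diag R y' ->
        f x y = f x' y' -> (x, y) = (x', y')) ->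
  diag R e0 -> diag R e1 -> e0 <> e1 ->
  (forall x, diag R x -> D (h x) /\ ~ diag R (h x)) ->
  (forall x y, diag R x -> diag R y -> h x = h y -> x = y) ->
  exists2 R', R `<` R' & square R'.
Proof.
move=> sR fR fE fi E0 E1 e01 hD hi; set E := diag R in fR fE fi E0 E1 hD hi *.
pose E' : set T := E `|` h @` E.
have /choice[p pP] : forall x, exists u : T * T, E' x ->
    [/\ E u.1, u.2 = e0 /\ x = u.1 \/ u.2 = e1 /\ x = h u.1 & u.2 = e0 <-> E x].
  move=> x; have [Ex|nEx] := pselect (E x).
    by exists (x, e0) => _; split=> //; left.
  have [[y Ey yx]|n] := pselect ((h @` E) x); last by exists (x, x) => -[/nEx|/n].
  exists (y, e1) => _; split=> //; first by right.
  by split=> [e10|/nEx//]; case: e01.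
have E'p x y : E' x -> E' y -> p x = p y -> x = y.
  move=> /pP[_ hx _] /pP[_ hy _] e; move: hx hy; rewrite e.
  by case=> -[e2 ex] [[e2' ey]|[e2' ey]]; congruence.
have Ep x : E' x -> E (p x).1 /\ E (p x).2.
  by move=> /pP[h1 [[-> _]|[-> _]] _].
pose g x y := h (f (f (p x).1 (p y).1) (f (p x).2 (p y).2)).
have gE x y : E' x -> E' y -> E (f (f (p x).1 (p y).1) (f (p x).2 (p y).2)).
  by move=> /Ep[? ?] /Ep[? ?]; do !apply: (fE).
have gi x y x' y' : E' x -> E' y -> E' x' -> E' y' -> g x y = g x' y' -> (x, y) = (x', y').
  move=> Ex Ey Ex' Ey' /hi e; have {e} := e (gE _ _ Ex Ey) (gE _ _ Ex' Ey').
  have [Ex1 Ex2] := Ep x Ex; have [Ey1 Ey2] := Ep y Ey.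
  have [Ex1' Ex2'] := Ep x' Ex'; have [Ey1' Ey2'] := Ep y' Ey'.
  move=> /(fi _ _ _ _ (fE _ _ Ex1 Ey1) (fE _ _ Ex2 Ey2) (fE _ _ Ex1' Ey1')
    (fE _ _ Ex2' Ey2'))[].
  move=> /(fi _ _ _ _ Ex1 Ey1 Ex1' Ey1')[e1x e1y].
  move=> /(fi _ _ _ _ Ex2 Ey2 Ex2' Ey2')[e2x e2y].
  by congr pair; apply: E'p => //; apply: injective_projections.
have [Rd Re Rf Ri RD] := sR.
pose R' : set (T * T * T) := R `|` [set u | [/\ E' u.1.1, E' u.1.2,
  ~ (E u.1.1 /\ E u.1.2) & u.2 = g u.1.1 u.1.2]].
have dR' : diag R' = E'.
  rewrite eqEsubset; split=> x.
    by move=> [z [xz|[]//]]; left; exists z.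
  have [Ex|nEx] := pselect (E x); first by case: Ex => z xz _; exists z; left.
  by move=> E'x; exists (g x x); right; split=> //= -[/nEx].
have hE x y : E' x -> E' y -> (h @` E) (g x y).
  by move=> E'x E'y; exists (f (f (p x).1 (p y).1) (f (p x).2 (p y).2)) => //; apply: gE.
have RE x y z : R (x, y, z) -> E' x /\ E' y.
  by move=> /Rd[? ? _]; split; left.
have sepE x y : E' x -> E' y -> ~ E (g x y).
  by move=> E'x E'y; have [] := hD _ (gE x y E'x E'y).
exists R'.
  split=> [u|]; first by left.
  have [DhE0 nhE0] := hD _ E0 => /(_ (h e0, h e0, g (h e0) (h e0))) hR.
  have : R (h e0, h e0, g (h e0) (h e0)).
    apply: hR; right; split=> //=; last by case.
    - by right; exists e0.
    - by right; exists e0.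
  by move=> /Rd[].
split; rewrite ?dR'.
- move=> x y z [/Rd[? ? ?]|[/= ? ? _ ->]]; first by split; left.
  by split=> //; right; apply: hE.
- move=> x y E'x E'y; have [[Ex Ey]|n] := pselect (E x /\ E y).
    by have [z xyz] := Re _ _ Ex Ey; exists z; left.
  by exists (g x y); right.
- move=> x y z z' [r|[/= ? ? n ->]] [r'|[/= _ _ n' ->]] //.
  + exact: Rf r r'.
  + by case: n'; have [? ? _] := Rd _ _ _ r.
  + by case: n; have [? ? _] := Rd _ _ _ r'.
- move=> x y x' y' z [r|[/= ? ? n ->]] [r'|[/= ? ? n' e]].
  + exact: Ri r r'.
  + by have [_ _] := Rd _ _ _ r; rewrite e => /sepE; case.
  + by have [_ _ /sepE[]] := Rd _ _ _ r'.
  + exact: gi.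
- by move=> x [/RD//|[y Ey <-]]; have [] := hD _ Ey.
Qed.

Lemma square_bigcup (F : set (set (T * T * T))) : F `<=` square ->
  total_on F subset -> square (\bigcup_(R in F) R).
Proof.
move=> Fsq Ftot; set U := \bigcup_(R in F) R.
have dir u v : U u -> U v -> exists R, [/\ F R, R u & R v].
  move=> [X FX Xu] [Y FY Yv]; have [XY|YX] := Ftot X Y FX FY.
    by exists Y; split=> //; exact: XY.
  by exists X; split=> //; exact: YX.
have diagU R x : F R -> diag R x -> diag U x by move=> FR [z xz]; exists z, R.
split.
- move=> x y z [R FR xyz]; have [Rd _ _ _ _] := Fsq _ FR.
  by have [? ? ?] := Rd _ _ _ xyz; split; apply: (diagU R).
- move=> x y [z xz] [t yt]; have [R [FR xz' yt']] := dir _ _ xz yt.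
  have [_ Re _ _ _] := Fsq _ FR.
  by have [w xyw] := Re x y (ex_intro _ z xz') (ex_intro _ t yt'); exists w, R.
- move=> x y z z' h h'; have [R [FR r r']] := dir _ _ h h'.
  by have [_ _ Rf _ _] := Fsq _ FR; apply: Rf r r'.
- move=> x y x' y' z h h'; have [R [FR r r']] := dir _ _ h h'.
  by have [_ _ _ Ri _] := Fsq _ FR; apply: Ri r r'.
- move=> x [z [R FR xz]]; have [_ _ _ _ RD] := Fsq _ FR.
  by apply: RD; exists z.
Qed.

Lemma square_base : infinite_set D -> exists2 R, square R & infinite_set (diag R).
Proof.
move=> /infiniteP Dinf.
have [x0 Dx0] : D !=set0 by apply: infinite_setN0; apply/infiniteP.
have [k [kD ki]] := card_le_inj x0 Dinf.
have {}ki i j : k i = k j -> i = j by apply: ki; apply/mem_set.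
pose R : set (T * T * T) :=
  [set u | exists i j, u = (k i, k j, k (pickle (i, j)))].
have dR x : diag R x <-> range k x.
  split=> [[z [i [j [-> _ _]]]]|[i _ <-]]; first by exists i.
  by exists (k (pickle (i, i))), i, i.
exists R; last first.
  apply/infiniteP; apply: (@inj_card_le_sub _ _ k); last by move=> i j _ _ /ki.
  by move=> i _; apply/dR; exists i.
split.
- move=> _ _ _ [i [j [-> -> ->]]].
  by split; apply/dR; [exists i|exists j|exists (pickle (i, j))].
- by move=> x y /dR[i _ <-] /dR[j _ <-]; exists (k (pickle (i, j))), i, j.
- by move=> x y z z' [i [j [-> -> ->]]] [i' [j' [/ki-> /ki-> ->]]].
- move=> x y x' y' z [i [j [-> -> ->]]] [i' [j' [-> -> /ki]]].
  by move=> /(pcan_inj pickleK)[-> ->].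
- by move=> x /dR[i _ <-]; apply: kD.
Qed.

Lemma card_square_le : infinite_set D -> D `*` D #<= D.
Proof.
move=> /square_base[R0 sR0 R0inf].
(* Taking unions with [R0] forces the maximal graph to have an infinite diagonal. *)
have [F FP Ftot|S [sR Smax]] := @Zorn_bigcup _ [set R | square (R0 `|` R)].
  rewrite /=; have [->|/set0P F0] := eqVneq F set0; first by rewrite bigcup_set0 setU0.
  rewrite -bigcupUr // -(bigcup_image F (setU R0) id).
  apply: square_bigcup => [_ [R FR <-]|_ _ [R FR <-] [R' FR' <-]]; first exact: FP.
  by have [h|h] := Ftot R R' FR FR'; [left|right]; apply: setUS.
rewrite /= in sR; set R := R0 `|` S in sR.
have Rmax R' : R `<` R' -> ~ square R'.
  move=> [RR' nR'R] sR'; apply: (Smax R'); last first.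
    by rewrite /= setUidr // => u R0u; apply: RR'; left.
  split=> [u Su|h]; first by apply: RR'; right.
  by apply: nR'R => u /h; right.
have Einf : infinite_set (diag R).
  by apply: sub_infinite_set R0inf => x [z xz]; exists z; left.
have [f [fR fE fi]] := square_fun sR.
have [e0 E0] := infinite_setN0 Einf.
have [e1 [E1 /= e10]] : (diag R `\ e0) !=set0.
  by apply: infinite_setN0; apply: infinite_setD => //; apply: finite_set1.
have EE : diag R `*` diag R #<= diag R.
  apply: (@inj_card_le_sub _ _ (fun u => f u.1 u.2)) => [[x y] [/= Ex Ey]|].
    exact: fE.
  move=> [x y] [x' y'] /set_mem[/= Ex Ey] /set_mem[/= Ex' Ey'].
  exact: fi.
have [_ _ _ _ ED] := sR.
(* If the rest of [D] is no larger than [diag R], then [D] embeds into two copies of [diag R], hence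
   into [diag R]. Otherwise [diag R] embeds into the rest and [R] can be enlarged. *)
have [/(card_le_inj e0)[k [kE ki]]|/(card_le_inj e0)[h [hD hi]]] :=
    card_le_total (D `\` diag R) (diag R).
  have DE : D #<= diag R.
    apply: card_le_trans EE.
    apply: (@inj_card_le_sub _ _ (fun x => if `[< diag R x >] then (x, e0) else (k x, e1))).
      move=> x Dx; case: asboolP => [Ex|nEx]; split=> //=.
      exact: kE.
    move=> x y /set_mem Dx /set_mem Dy.
    case: asboolP => [Ex|nEx]; case: asboolP => [Ey|nEy] [] //.
    - by move=> _ /esym.
    - by move=> kxy; apply: ki => //; apply/mem_set.
  apply: card_le_trans (card_le_trans EE (subset_card_le ED)).
  have [g [gE gi]] := card_le_inj e0 DE.
  apply: (@inj_card_le_sub _ _ (fun u => (g u.1, g u.2))).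
    by move=> [x y] [/= Dx Dy]; split; apply: gE.
  move=> [x y] [x' y'] /set_mem[/= Dx Dy] /set_mem[/= Dx' Dy'] [exx eyy].
  by congr pair; apply: gi => //; apply/mem_set.
have [||R' RR' sR'] := @square_extend R f h e0 e1 sR fR fE fi E0 E1 (nesym e10).
- by move=> x /hD[].
- by move=> x y Ex Ey; apply: hi; apply/mem_set.
- by case: (Rmax R' RR').
Qed.

End Square.

End Cardinals.

(** * The rank of an intersection *)

(** Reduced words are coded by iterated pairing in [D]. The length is recorded too, because the code
    of the empty word may also be that of a longer one. *)
Lemma card_free_le (G : groupType) (H X : set G) (T : Type) (D : set T) :
  free_basis H X -> infinite_set D -> (X #<= D)%card -> (H #<= D)%card.
Proof.
move=> HX Dinf XD; have [d0 Dd0] := infinite_setN0 Dinf.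
have [g [gD gi]] := card_le_inj d0 XD.
have [p [pD pi]] := card_le_inj d0 (card_square_le Dinf).
have [k [kD ki]] := card_le_inj d0 ((infiniteP _).1 Dinf).
have {}ki i j : k i = k j -> i = j by apply: ki; apply/mem_set.
have {}kD i : D (k i) by apply: kD.
have {}pi x y x' y' : D x -> D y -> D x' -> D y' -> p (x, y) = p (x', y') ->
    x = x' /\ y = y'.
  move=> Dx Dy Dx' Dy' e.
  have h : (x, y) = (x', y') by apply: pi => //; apply/mem_set; split.
  by case: h.
have {}pD x y : D x -> D y -> D (p (x, y)) by move=> ? ?; apply: pD.
pose enc := fix enc (w : seq (G * bool)) :=
  if w is l :: w' then p (p (g l.1, k (nat_of_bool l.2)), enc w') else k 0%N.
have encD w : word_over X w -> D (enc w).
  elim: w => [_|l w IH /word_over_cons[Xl /IH Dw]]; first exact: kD.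
  exact: pD (pD _ _ (gD _ Xl) (kD _)) Dw.
have enc_inj w w' : word_over X w -> word_over X w' -> size w = size w' ->
    enc w = enc w' -> w = w'.
  elim: w w' => [|l w IH] [|l' w'] //= /word_over_cons[Xl ow] /word_over_cons[Xl' ow'].
  move=> [/(IH _ ow ow')ww'].
  have Dl (m : G * bool) : X m.1 -> D (p (g m.1, k m.2)) by move=> Xm; apply: pD => //; apply: gD.
  move=> /(pi _ _ _ _ (Dl _ Xl) (encD _ ow) (Dl _ Xl') (encD _ ow'))[+ /ww' ->].
  move=> /(pi _ _ _ _ (gD _ Xl) (kD _) (gD _ Xl') (kD _))[gl /ki bl].
  congr cons; apply: injective_projections; first by apply: gi => //; apply/mem_set.
  by case: l.2 l'.2 bl {gl} => [] [].
apply: (@inj_card_le_sub _ _ (fun h => p (k (size (fword X h)), enc (fword X h)))).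
  by move=> h /(fwordP HX)[ow _ _]; apply: pD => //; apply: encD.
move=> h h' /set_mem Hh /set_mem Hh'.
have [ow _ _] := fwordP HX Hh; have [ow' _ _] := fwordP HX Hh'.
move=> /(pi _ _ _ _ (kD _) (encD _ ow) (kD _) (encD _ ow'))[/ki es].
by move=> /(enc_inj _ _ ow ow' es); apply: (fword_inj HX).
Qed.

Section Rank.
Variable G : groupType.
Implicit Types (A B F X Y Z : set G).

Lemma basis_neq0 A X : subgroup A -> free_basis A X -> A <> [set 1] -> X !=set0.
Proof.
move=> sA AX nt; apply: contrapT => X0; apply: nt.
rewrite eqEsubset; split=> [a /(fwordP AX)[ow _ <-]|_ ->]; last exact: subgroup1.
case: (fword X a) ow => [|l w]; first by rewrite word_value_nil.
by move=> /word_over_cons[Xl _]; case: X0; exists l.1.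
Qed.

Lemma basis1_commute A x : subgroup A -> free_basis A [set x] ->
  forall a b, A a -> A b -> a * b = b * a.
Proof.
move=> sA Ax.
have comm_ind c : c * x = x * c -> forall a, A a -> a * c = c * a.
  move=> cx; apply: (basis_ind sA Ax) => [|l h /= lx Ah hc].
    by rewrite mul1g mulg1.
  have lc : letter l * c = c * letter l.
    rewrite /letter lx; case: l.2; last by rewrite cx.
    by apply: (mulgI x); rewrite mulVKg mulgA -cx mulgK.
  by rewrite -mulgA hc mulgA lc mulgA.
have xA a : A a -> a * x = x * a by apply: comm_ind.
by move=> a b Aa Ab; apply: comm_ind => //; apply: xA.
Qed.

(** For distinct [x] and [y] in [Z], the words [x y] and [y x] are distinct and reduced, hence have
    different values. *)
Lemma basis_commute_subset1 A Z : subgroup A -> free_basis A Z ->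
  (forall a b, A a -> A b -> a * b = b * a) -> is_subset1 Z.
Proof.
move=> sA AZ com x y Zx Zy; apply: contrapT => /eqP xy.
have Ax := basis_sub AZ Zx; have Ay := basis_sub AZ Zy.
have ow u v : Z u -> Z v -> word_over Z [:: (u, false); (v, false)].
  by move=> Zu Zv; apply/word_over_cons; split=> //; apply: word_over1.
have rw (u v : G) : reduced [:: (u, false); (v, false)].
  by rewrite reducedE /= /nocancel /linv /= xpair_eqE andbF.
have vw (u v : G) : word_value [:: (u, false); (v, false)] = u * v.
  by rewrite !word_value_cons word_value_nil mulg1.
have := fword_value sA AZ (ow x y Zx Zy) (rw _ _).
rewrite vw com // -vw (fword_value sA AZ (ow y x Zy Zx)) // => -[yx _].
by rewrite yx eqxx in xy.
Qed.

Lemma minus_one_set0 X : X !=set0 -> minus_one 1 X = set0 -> exists x, X = [set x].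
Proof.
move=> [x Xx] X0; exists (xget 1 X); rewrite eqEsubset; split=> [y Xy|_ ->].
  by apply: contrapT => ny; have : minus_one 1 X y by []; rewrite X0.
exact: (xgetI 1 Xx).
Qed.

Lemma minus_one_subset1 X : is_subset1 X -> minus_one 1 X = set0.
Proof.
move=> X1; rewrite -subset0 => x [Xx]; apply => /=; apply: X1 => //.
exact: (xgetI 1 Xx).
Qed.

(** Here [A] is cyclic, so the intersection is abelian and has rank at most 1: the left side is
    already 0, whatever [C] is. *)
Lemma minus_one_le_of_abelian A B X Z (U : Type) (C : set U) :
  subgroup A -> subgroup B ->
  free_basis A X -> X !=set0 -> free_basis (A `&` B) Z -> minus_one 1 X = set0 ->
  (minus_one 1 Z #<= C)%card.
Proof.
move=> sA sB AX X0 CZ /(minus_one_set0 X0)[x eX]; rewrite {}eX in AX.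
rewrite minus_one_subset1 ?card_ge0 //.
apply: (basis_commute_subset1 (subgroupI sA sB) CZ) => a b [Aa _] [Ab _].
exact: (basis1_commute sA AX).
Qed.

Lemma card_le_of_minus_one X (T : Type) (D : set T) : infinite_set D ->
  X !=set0 -> (minus_one 1 X #<= D)%card -> (X #<= D)%card.
Proof.
move=> Dinf X0 XD; have [d0 Dd0] := infinite_setN0 Dinf.
have [d1 [Dd1 /= d10]] : (D `\ d0) !=set0.
  by apply: infinite_setN0; apply: infinite_setD => //; apply: finite_set1.
have [f [fD fi]] := card_le_inj d0 XD.
apply: card_le_trans (card_square_le Dinf).
apply: (@inj_card_le_sub _ _ (fun x => if x == xget 1 X then (d0, d0) else (f x, d1))).
  move=> x Xx; case: eqVneq => [_|nx]; split=> //=.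
  by apply: fD; split=> //; apply/eqP.
move=> x y /set_mem Xx /set_mem Xy.
case: (eqVneq x) => [->|nx]; case: (eqVneq y) => [->|ny] // [].
- by move=> _ /esym.
- by [].
- by move=> fxy; apply: fi => //; apply/mem_set; split=> //; apply/eqP.
Qed.

Lemma seq_card_le (T U : eqType) (s : seq T) (t : seq U) :
  (size s <= size t)%N -> uniq t -> ([set` s] #<= [set` t])%card.
Proof.
case: t => [|u0 t'] st ut; first by move: st; rewrite leqn0 => /nilP->; rewrite set_nil card_ge0.
set t := u0 :: t' in st ut *.
have sz x : x \in s -> (index x s < size t)%N.
  by move=> xs; apply: leq_trans st; rewrite index_mem.
apply: (@inj_card_le_sub _ _ (fun x => nth u0 t (index x s))).
  by move=> x /= xs; rewrite mem_nth // sz.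
move=> x y /set_mem /= xs /set_mem /= ys /eqP.
by rewrite nth_uniq ?sz // => /eqP e; rewrite -(nth_index x xs) e nth_index.
Qed.

Lemma finite_set_uniq (T : choiceType) (S : set T) : finite_set S ->
  exists2 s : seq T, uniq s & S = [set` s].
Proof.
move=> /finite_seqP[s ->]; exists (undup s); first exact: undup_uniq.
by rewrite eqEsubset; split=> x /=; rewrite mem_undup.
Qed.

Lemma minus_one_seq (s : seq G) : uniq s -> [set` s] !=set0 ->
  exists2 t : seq G, uniq t /\ size s = (size t).+1 & minus_one 1 [set` s] = [set` t].
Proof.
move=> us [x xs]; set y := xget 1 [set` s].
have ys : y \in s := xgetI 1 xs.
exists (rem y s).
  by rewrite rem_uniq // size_rem // prednK //; case: (s) ys.
rewrite eqEsubset /minus_one -/y; split=> z /=; rewrite mem_rem_uniq // !inE.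
  by move=> [zs /eqP ->].
by move=> /andP[/eqP ? ?].
Qed.

Lemma minus_one_le_of_finite A B F X Y Z :
  subgroup A -> subgroup B -> free_subgroup F ->
  free_basis A X -> free_basis B Y -> free_basis (A `&` B) Z ->
  X !=set0 -> Y !=set0 -> Z !=set0 ->
  finite_set (left_cosets F) -> finite_set X -> finite_set Y ->
  (minus_one 1 Z #<= left_cosets F `*` (minus_one 1 X `*` minus_one 1 Y))%card.
Proof.
move=> sA sB [sF [W FW]] AX BY CZ X0 Y0 Z0 finF finX finY.
have [sc usc esc] := finite_set_uniq finF.
have [sx usx esx] := finite_set_uniq finX; have [sy usy esy] := finite_set_uniq finY.
pose lc (g : G) : set G := [set g * f | f in F].
have lc_sc g : lc g \in sc.
  have h : left_cosets F (lc g) by exists g.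
  by rewrite esc in h.
have lcP x y : lc x = lc y <-> F (x^-1 * y).
  split=> [e|xy].
    have : lc y y by exists 1; [exact: subgroup1|rewrite mulg1].
    by rewrite -e => -[f Ff <-]; rewrite mulKg.
  rewrite eqEsubset; split=> _ [f Ff <-].
    exists ((x^-1 * y)^-1 * f); first by apply: subgroupM => //; apply: subgroupV.
    by rewrite invgM invgK !mulgA mulgV mul1g.
  by exists (x^-1 * y * f); [exact: subgroupM|rewrite !mulgA mulgV mul1g].
have lt_index g : (index (lc g) sc < size sc)%N by rewrite index_mem.
pose coset g := Ordinal (lt_index g).
have cosetP x y : coset x = coset y <-> F (x^-1 * y).
  rewrite -lcP; split=> [[]|e]; last by apply: val_inj; rewrite /= e.
  by move=> e; rewrite -(nth_index set0 (lc_sc x)) e nth_index.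
have /choice[base coset_base] : forall i, exists g, coset g = i.
  move=> i; have : left_cosets F (nth set0 sc i) by rewrite esc /= mem_nth.
  by case=> g _ e; exists g; apply: val_inj; rewrite /= /lc e index_uniq.
have [lt [lt_irr lt_tr lt_tot]] := strict_total_order_exists (G * bool)%type.
have bound zs : uniq zs -> [set` zs] `<=` Z ->
    (size zs * size sc + size sx * size sc * size sc + size sy * size sc * size sc
     <= (size sx * size sc) * (size sy * size sc) + size sc + size sc * size sc)%N.
  move=> uzs zsZ.
  apply: (@intersection_rank_bound _ F W sF FW lt lt_irr lt_tr lt_tot _ coset base
    cosetP coset_base A B X Y Z _ _ _ (tnth (in_tuple sx)) (tnth (in_tuple sy))
    (tnth (in_tuple zs)) sA sB AX BY CZ X0 Y0 Z0) => [i|x|i|y||i].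
  - by rewrite esx /= mem_tnth.
  - by rewrite esx /= => xs; exact/tnthP.
  - by rewrite esy /= mem_tnth.
  - by rewrite esy /= => ys; exact/tnthP.
  - exact/tuple_uniqP.
  - by apply: zsZ; rewrite /= mem_tnth.
have sc0 : (0 < size sc)%N by case: (sc) (lc_sc 1).
rewrite esx in X0 *; rewrite esy in Y0 *.
have [tx [utx sztx] ->] := minus_one_seq usx X0.
have [ty [uty szty] ->] := minus_one_seq usy Y0.
rewrite sztx szty in bound.
(* One factor [size sc] is cancelled; the final successor is the 1 subtracted from the rank on the
   left. *)
have {}bound zs : uniq zs -> [set` zs] `<=` Z ->
    (size zs <= (size sc * (size tx * size ty)).+1)%N.
  by move=> uzs /(bound _ uzs) h; rewrite -(leq_pmul2r sc0); nia.
(* All finite parts of [Z] obey the same bound, and [.+2] is one more than it. *)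
have finZ : finite_set Z.
  apply: contrapT => /(infinite_set_fset (size sc * (size tx * size ty)).+2)[zs zsZ].
  by rewrite leqNgt ltnS bound // finmap.fset_uniq.
have [sz usz esz] := finite_set_uniq finZ.
have szZ := bound _ usz; rewrite esz in szZ Z0 *.
have [tz [utz sztz] ->] := minus_one_seq usz Z0.
pose t := [seq (c, u) | c <- sc, u <- [seq (x, y) | x <- tx, y <- ty]].
have /card_le_trans : ([set` tz] #<= [set` t])%card.
  apply: seq_card_le; first by rewrite !size_allpairs -ltnS -sztz szZ.
  apply: allpairs_uniq => //; last by move=> [? ?] [? ?].
  by apply: allpairs_uniq => //; move=> [? ?] [? ?].
apply; rewrite esc; apply: subset_card_le => _ /allpairsP[[c _] [/= ct /allpairsP[[x y] [/= xt yt ->]] ->]].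
by split.
Qed.

End Rank.

Theorem theorem1 (G : groupType) (A B F : set G)
    (freeA : free_subgroup A) (freeB : free_subgroup B)
    (freeF : free_subgroup F)
    (ntA : A <> [set 1]) (ntB : B <> [set 1]) (ntF : F <> [set 1])
    (X Y Z : set G)
    (basisA : free_basis A X) (basisB : free_basis B Y)
    (basisAB : free_basis (A `&` B) Z) :
  minus_one_le 1 Z (left_cosets F `*` (minus_one 1 X `*` minus_one 1 Y)).
Proof.
have [->|/set0P Z0] := eqVneq Z set0; [by left|right].
have [[sA _] [sB _]] := (freeA, freeB).
have X0 := basis_neq0 sA basisA ntA; have Y0 := basis_neq0 sB basisB ntB.
have [eX|/set0P[x Xx]] := eqVneq (minus_one 1 X) set0.
  exact: (minus_one_le_of_abelian _ sA sB basisA X0 basisAB eX).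
have [eY|/set0P[y Yy]] := eqVneq (minus_one 1 Y) set0.
  by rewrite setIC in basisAB; exact: (minus_one_le_of_abelian _ sB sA basisB Y0 basisAB eY).
set C := left_cosets F `*` _.
have cosetF : left_cosets F [set 1 * f | f in F] by exists 1.
(* No factor of [C] is empty, so each embeds into [C] with the other coordinates fixed. *)
have XC : (minus_one 1 X #<= C)%card.
  by apply: (@inj_card_le_sub _ _ (fun x => ([set 1 * f | f in F], (x, y)))) => [|? ? _ _ []].
have YC : (minus_one 1 Y #<= C)%card.
  by apply: (@inj_card_le_sub _ _ (fun y => ([set 1 * f | f in F], (x, y)))) => [|? ? _ _ []].
have FC : (left_cosets F #<= C)%card.
  by apply: (@inj_card_le_sub _ _ (fun c => (c, (x, y)))) => [|? ? _ _ []].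
have [finC|infC] := pselect (finite_set C).
  have finite_basis S : finite_set (minus_one 1 S) -> finite_set S.
    move=> finS; apply: (@sub_finite_set _ _ (minus_one 1 S `|` [set xget 1 S])).
      by move=> s Ss; have [->|ns] := eqVneq s (xget 1 S); [right|left; split=> //; apply/eqP].
    by rewrite finite_setU; split.
  apply: (minus_one_le_of_finite sA sB freeF basisA basisB basisAB X0 Y0 Z0).
  - exact: card_le_finite FC finC.
  - exact/finite_basis/(card_le_finite XC).
  - exact/finite_basis/(card_le_finite YC).
(* For infinite [C] the group [A] itself has at most [C] elements, and [Z] lies in [A]. *)
have AC := card_free_le basisA infC (card_le_of_minus_one infC X0 XC).
apply: card_le_trans (subset_card_le _) AC => z [Zz _].
by have [] := basis_sub basisAB Zz.
Qed.
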